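(* Let $U,V$ be domains in $\mathbb C^d$. Let $\sigma:\mathbb C^d\to\mathbb C^d$ be an affine-linear involution such that $J_\sigma=-1$ and let $\phi:U\to V$ be a $\sigma$-invariant $2$-proper holomorphic map. Then $$\{g\in\mathrm{Hol}(U): g\circ\sigma=g\}=\{f\circ\phi: f\in\mathrm{Hol}(V)\}.$$
   Context: A domain is a nonempty open connected subset of $\mathbb C^d$; $\mathrm{Hol}(U)$ is the space of complex-valued holomorphic functions on $U$. A map $\psi:\mathbb C^d\to\mathbb C^d$ is affine-linear if $\psi(z)=Az+B$ for a linear operator $A$ on $\mathbb C^d$ and $B\in\mathbb C^d$. $J_\psi$ denotes the determinant of the complex Jacobian matrix of a holomorphic map $\psi$, and $Z(f)$ is the zero set of a function $f$. An involution is a continuous map $\sigma:\mathbb C^d\to\mathbb C^d$ with $\sigma\circ\sigma=I$. $U$ is $\sigma$-invariant if $\sigma(z)\in U$ for every $z\in U$; a map $\phi:U\to V$ is $\sigma$-invariant if $U$ is $\sigma$-invariant and $\phi\circ\sigma=\phi$. A continuous map $\phi:U\to V$ is proper if the preimage of every compact subset of $V$ is compact. A proper holomorphic map $\phi:U\to V$ is $m$-proper (has multiplicity $m$) if $\mathrm{card}(\phi^{-1}(\{z\}))=m$ for every $z\in V\setminus\phi(Z(J_\phi))$ and $\mathrm{card}(\phi^{-1}(\{z\}))<m$ for every $z\in\phi(Z(J_\phi))$. *)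

(* Defs.v *)
From HB Require Import structures.
From mathcomp Require Import all_boot all_order all_algebra.
From mathcomp Require Import all_classical all_reals all_analysis.
From mathcomp Require Import complex.
Import numFieldNormedType.Exports.

Set Implicit Arguments.
Unset Strict Implicit.
Unset Printing Implicit Defensive.

Import Order.TTheory GRing.Theory Num.Theory.
Local Open Scope classical_set_scope.
Local Open Scope card_scope.
Local Open Scope ring_scope.

(* The codomain [numClosedFieldType] is what makes the canonical norm and
   topology available on [C R] and on ['rV[C R]_d]; the bare type [R[i]] does
   not carry them. *)
Definition C (R : realType) : numClosedFieldType := R[i].

Notation Cn R d := 'rV[C R]_d.

Definition domain (R : realType) (d : nat) (U : set (Cn R d)) : Prop :=
  [/\ U !=set0, open U & connected U].

(* Complex Frechet differentiability at every point, the scalar field of the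
   normed modules being [C R].  As for all maps below, maps with source U are
   total functions of which only the values on U matter; since U is open in all
   uses, [differentiable f z] at z in U depends only on these values. *)
Definition holomorphic_on (R : realType) (d : nat) (W : normedModType (C R))
    (U : set (Cn R d)) (f : Cn R d -> W) : Prop :=
  forall z, U z -> differentiable f z.

(* A function U -> C R is identified with the total function that agrees with
   it on U and takes the fixed value [point] outside U, so that equality in
   [Hol U] is equality of functions on U. *)
Definition Hol (R : realType) (d : nat) (U : set (Cn R d)) :
    set (Cn R d -> C R) :=
  [set f \_ U | f in [set f : Cn R d -> C R | holomorphic_on U f]].

Definition affine_linear (R : realType) (d : nat) (psi : Cn R d -> Cn R d) :
    Prop :=
  exists (A : {linear Cn R d -> Cn R d}) (B : Cn R d),
    forall z, psi z = A z + B.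

(* [jacobian] is the transpose of the usual Jacobian matrix (it acts on row
   vectors from the right), which does not affect the determinant. *)
Definition jac_det (R : realType) (d : nat) (psi : Cn R d -> Cn R d)
    (z : Cn R d) : C R :=
  \det (jacobian psi z).

Definition zero_set (R : realType) (d : nat) (U : set (Cn R d))
    (f : Cn R d -> C R) : set (Cn R d) :=
  [set z | U z /\ f z = 0].

Definition is_involution (R : realType) (d : nat)
    (sigma : Cn R d -> Cn R d) : Prop :=
  continuous sigma /\ sigma \o sigma = id.

Definition invariant_set (R : realType) (d : nat)
    (sigma : Cn R d -> Cn R d) (U : set (Cn R d)) : Prop :=
  forall z, U z -> U (sigma z).

Definition invariant_map (R : realType) (d : nat)
    (sigma : Cn R d -> Cn R d) (U : set (Cn R d))
    (phi : Cn R d -> Cn R d) : Prop :=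
  invariant_set sigma U /\ forall z, U z -> phi (sigma z) = phi z.

Definition proper_map (R : realType) (d : nat) (U V : set (Cn R d))
    (phi : Cn R d -> Cn R d) : Prop :=
  [/\ set_fun U V phi,
      {within U, continuous phi}
    & forall K, K `<=` V -> compact K -> compact (U `&` phi @^-1` K)].

Definition fiber (R : realType) (d : nat) (U : set (Cn R d))
    (phi : Cn R d -> Cn R d) (w : Cn R d) : set (Cn R d) :=
  U `&` phi @^-1` [set w].

Definition critical_values (R : realType) (d : nat) (U : set (Cn R d))
    (phi : Cn R d -> Cn R d) : set (Cn R d) :=
  phi @` zero_set U (jac_det phi).

Definition m_proper_holomorphic (R : realType) (d m : nat)
    (U V : set (Cn R d)) (phi : Cn R d -> Cn R d) : Prop :=
  [/\ proper_map U V phi,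
      holomorphic_on U phi,
      forall w, (V `\` critical_values U phi) w -> fiber U phi w #= `I_m
    & forall w, critical_values U phi w ->
        exists2 k, (k < m)%N & fiber U phi w #= `I_k].

(* Main.v *)
Require Import Defs.
From HB Require Import structures.
From mathcomp Require Import all_boot all_order all_algebra.
From mathcomp Require Import all_classical all_reals all_analysis.
From mathcomp Require Import complex.
From mathcomp Require Import ring lra.
Import numFieldNormedType.Exports.
Import Order.TTheory GRing.Theory Num.Theory.
Local Open Scope classical_set_scope.
Local Open Scope ring_scope.
Set Implicit Arguments.
Unset Strict Implicit.
Unset Printing Implicit Defensive.

(** Composition with [phi] sends [Hol V] into the invariant functions by the
chain rule. For the converse, the fibres of [phi] are exactly the orbits of
[sigma]: at a fixed point of [sigma], the chain rule for [phi \o sigma = phi]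
together with [J_sigma = -1] gives [J_phi = - J_phi], so fixed points are
critical; and a critical point is fixed because the fibre over a critical value
has fewer than two elements ([fixed_critical], [critical_fixed],
[fiber_orbit]). Hence an invariant [g] is [f \o phi] for a function [f] on [V].
Properness makes [phi] a closed map ([phi_closed]), which gives the continuity
of [f]; at [phi z] with [sigma z != z] the differential of [phi] is invertible
and the local inverse is continuous, so that [f] is differentiable there
([descent_differentiable]).

The singularities of [f] along the critical values are removed without any
description of that set. A coordinate of [z - sigma z] is changed into its
opposite by [sigma], so its square descends too, to a continuous function [h]
on [V] which is differentiable where it does not vanish, and which vanishes at
all critical values. As in Rado's theorem, the maximum principle holds for
[f ^+ n * h], whatever happens at the zeros of [h], and letting [n] go to
infinity gives it for [f] itself off these zeros ([rado_max_modulus]). Divided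
differences of [f] on a complex line are functions of the same kind, so the
principle bounds the second divided differences of [f] uniformly over the lines
([rado_second_difference]). At the points where [h] does not vanish, [f] thus
has first order Taylor expansions with a uniform quadratic remainder; these
points are dense, and the expansions pass to the limit
([rado_differentiable]).

The maximum principle itself has to start from complex differentiability at
each point, without continuity of the derivative. Goursat's bisection argument
kills the contour integrals over rectangles ([goursat_except]); this yields the
Cauchy estimate that a value at the centre of a square is at most twice the
maximum on the sides ([cauchy_center_bound]). The factor two is harmless:
applied to all the powers of a function, the estimate shows that the function
is locally constant near a maximum of its modulus ([local_constant]). *)

(** * The real-valued norm of a complex normed module *)

Section RealNorm.
Local Open Scope complex_scope.
Context {R : realType}.
Implicit Types V W : normedModType (C R).

(** Norms are complex numbers here, hence only partially ordered; as they are
real, their real part carries the same information. *)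
Definition rnorm (V : normedModType (C R)) (x : V) : R := complex.Re (`|x| : C R).

Lemma rnormE V (x : V) : `|x| = (rnorm x)%:C :> C R.
Proof.
have x0 : (0 : R[i]) <= `|x| by exact: (normr_ge0 x : 0 <= `|x| :> C R).
by rewrite /rnorm (RRe_real (ger0_real x0)).
Qed.

Lemma rnorm_ge0 V (x : V) : 0 <= rnorm x.
Proof. by rewrite -(@ler0c R) -rnormE; exact: (normr_ge0 x). Qed.

Lemma rnorm0 V : rnorm (0 : V) = 0.
Proof. by rewrite /rnorm normr0. Qed.

Lemma rnorm_eq0 V (x : V) : (rnorm x == 0) = (x == 0).
Proof.
have := rnormE x; rewrite -(normr_eq0 x) => ->; by rewrite -(inj_eq (@complexI R)).
Qed.

Lemma rnorm_gt0 V (x : V) : (0 < rnorm x) = (x != 0).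
Proof. by rewrite lt_def rnorm_ge0 andbT rnorm_eq0. Qed.

Lemma rnormN V (x : V) : rnorm (- x) = rnorm x.
Proof. by rewrite /rnorm normrN. Qed.

Lemma rnorm_distC V (x y : V) : rnorm (x - y) = rnorm (y - x).
Proof. by rewrite -rnormN opprB. Qed.

Lemma rnormD V (x y : V) : rnorm (x + y) <= rnorm x + rnorm y.
Proof.
rewrite -(@lecR R) rmorphD /= -!rnormE; exact: ler_normD.
Qed.

Lemma rnorm_triangle V (x y z : V) : rnorm (x - z) <= rnorm (x - y) + rnorm (y - z).
Proof. by have := rnormD (x - y) (y - z); rewrite subrKA. Qed.

Lemma rnormB_le V (x y : V) : rnorm (x - y) <= rnorm x + rnorm y.
Proof. by rewrite -(rnormN y); exact: rnormD. Qed.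

Lemma rnorm_sub_ge V (x y : V) : rnorm x - rnorm y <= rnorm (x - y).
Proof. by rewrite lerBlDr; have := rnormD (x - y) y; rewrite subrK. Qed.

Lemma rnormZ V (a : C R) (x : V) : rnorm (a *: x) = rnorm a * rnorm x.
Proof.
apply: (@complexI R); rewrite rmorphM /= -!rnormE; exact: normrZ.
Qed.

Lemma rnormM (a b : C R) : rnorm (a * b) = rnorm a * rnorm b.
Proof. exact: rnormZ. Qed.

Lemma rnormX (a : C R) n : rnorm (a ^+ n) = rnorm a ^+ n.
Proof.
elim: n => [|n IH]; last by rewrite !exprS rnormM IH.
by rewrite !expr0 /rnorm normr1.
Qed.

Lemma rnormV (a : C R) : rnorm (a^-1) = (rnorm a)^-1.
Proof. by apply: (@complexI R); rewrite fmorphV /= -!rnormE normfV. Qed.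

Lemma rnorm_real (x : R) : rnorm (x%:C : C R) = `|x|.
Proof. by rewrite /rnorm; have := @normc_def R x%:C => ->/=; rewrite expr0n addr0 sqrtr_sqr. Qed.

Lemma rnorm_Re (z : C R) : `|complex.Re z| <= rnorm z.
Proof. by rewrite -(@lecR R) -rnormE; exact: normc_ge_Re. Qed.

Lemma rnorm_i : rnorm ('i : C R) = 1.
Proof. by rewrite /rnorm; have := @normc_def R 'i => ->/=; rewrite expr0n expr1n add0r sqrtr1. Qed.

Lemma rnorm_Im (z : C R) : `|complex.Im z| <= rnorm z.
Proof.
have := rnorm_Re ((z : R[i]) * 'i : C R).
by rewrite ReiNIm normrN rnormM rnorm_i mulr1.
Qed.

Lemma rnorm_le_ReIm (z : C R) : rnorm z <= `|complex.Re z| + `|complex.Im z|.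
Proof.
rewrite {1}[z](@complexE R); apply: le_trans (rnormD _ _) _.
by rewrite rnormM rnorm_i mul1r !rnorm_real.
Qed.

Lemma ReD (x y : C R) : complex.Re (x + y) = complex.Re x + complex.Re y.
Proof. by case: x y => [? ?] [? ?]. Qed.
Lemma ImD (x y : C R) : complex.Im (x + y) = complex.Im x + complex.Im y.
Proof. by case: x y => [? ?] [? ?]. Qed.
Lemma ReN (x : C R) : complex.Re (- x) = - complex.Re x.
Proof. by case: x => [? ?]. Qed.
Lemma ImN (x : C R) : complex.Im (- x) = - complex.Im x.
Proof. by case: x => [? ?]. Qed.
Lemma ReB (x y : C R) : complex.Re (x - y) = complex.Re x - complex.Re y.
Proof. by rewrite ReD ReN. Qed.
Lemma ImB (x y : C R) : complex.Im (x - y) = complex.Im x - complex.Im y.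
Proof. by rewrite ImD ImN. Qed.

Lemma nbhs_rnormP V (x : V) (A : set V) :
  nbhs x A <-> exists2 d : R, 0 < d & forall y, rnorm (y - x) < d -> A y.
Proof.
split=> [/nbhs_normP[e /= e0 eA]|[d d0 dA]].
- have ee : (rnorm (e : C R))%:C = e by rewrite -rnormE gtr0_norm.
  exists (rnorm (e : C R)); first by rewrite -ltcR ee.
  move=> y yd; apply: eA; rewrite /= distrC rnormE -ee ltcR. exact: yd.
- apply/nbhs_normP; exists (d%:C : C R); first by rewrite /= ltcR.
  by move=> y /=; rewrite rnormE ltcR => xy; apply: dA; rewrite rnorm_distC.
Qed.

Lemma cvg_rnormP (T : Type) (F : set_system T) (FF : Filter F) W (f : T -> W) (l : W) :
  f @ F --> l <-> forall e : R, 0 < e -> \forall x \near F, rnorm (f x - l) < e.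
Proof.
split=> [fl e e0|fl].
- by apply: (fl [set y | rnorm (y - l) < e]); apply/nbhs_rnormP; exists e.
- move=> A /nbhs_rnormP[d d0 dA]; have := fl d d0; rewrite /= /nbhs /=.
  by apply: filterS => x /dA.
Qed.

Lemma open_rnormP V (A : set V) :
  (forall x : V, A x -> exists2 d : R, 0 < d & forall y : V, rnorm (y - x) < d -> A y) ->
  open A.
Proof. by move=> H; rewrite openE => x /H /nbhs_rnormP. Qed.

Lemma continuous_rnormP V W (f : V -> W) (x : V) :
  {for x, continuous f} <-> forall e : R, 0 < e -> exists2 d : R, 0 < d &
    forall y, rnorm (y - x) < d -> rnorm (f y - f x) < e.
Proof.
split=> [/cvg_rnormP fl e /fl /nbhs_rnormP //|H].
by apply/cvg_rnormP => e /H /nbhs_rnormP.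
Qed.

Lemma continuous_real V (g : V -> R) (z : V) :
  (forall e : R, 0 < e -> exists2 d : R, 0 < d & forall w, rnorm (w - z) < d -> `|g z - g w| < e) ->
  {for z, continuous g}.
Proof. by move=> H; apply/cvgrPdist_lt => e /H /nbhs_rnormP. Qed.

Lemma continuous_linear_rnorm V W (D : {linear V -> W}) : continuous D ->
  exists2 k : R, 0 < k & forall x, rnorm (D x) <= k * rnorm x.
Proof.
move=> Dc; have [/= k k0 kD] := linear_lipschitz Dc.
have kk : (rnorm (k : C R))%:C = k by rewrite -rnormE gtr0_norm.
exists (rnorm (k : C R)); first by rewrite -ltcR kk.
by move=> x; rewrite -(@lecR R) rmorphM /= kk -!rnormE.
Qed.

Lemma linear_bounded_continuous_rnorm V W (D : {linear V -> W}) (k : R) :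
  (forall x, rnorm (D x) <= k * rnorm x) -> continuous D.
Proof.
move=> kD x; apply/continuous_rnormP => e e0.
have k1 : 0 < `|k| + 1 by rewrite ltr_wpDl.
exists (e / (`|k| + 1)); first by rewrite divr_gt0.
move=> y; rewrite ltr_pdivlMr// => ye.
rewrite -linearB; apply: le_lt_trans (kD _) _; apply: le_lt_trans ye.
rewrite mulrC ler_wpM2l ?rnorm_ge0// (le_trans (ler_norm _))// lerDl//.
Qed.

Lemma differentiable_bound V W (f : V -> W) (x : V) : differentiable f x ->
  forall e : R, 0 < e -> exists2 d : R, 0 < d &
    forall h, rnorm h < d -> rnorm (f (x + h) - f x - 'd f x h) <= e * rnorm h.
Proof.
move=> dx e e0; have /eqaddoP /(_ e%:C) := diff_locally dx.
rewrite ltcR => /(_ e0) /nbhs_rnormP[d d0 dH]; exists d => // h hd.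
have := dH h; rewrite subr0 => /(_ hd).
rewrite !rnormE -rmorphM lecR /= opprD addrA [x + h]addrC; exact.
Qed.

(** Any continuous linear map with the expansion property witnesses
differentiability, because differentials are unique. *)
Lemma differentiable_rnormP V W (f : V -> W) (x : V) : differentiable f x <->
  exists2 D : {linear V -> W}, continuous D & forall e : R, 0 < e -> exists2 d : R, 0 < d &
    forall h, rnorm h < d -> rnorm (f (x + h) - f x - D h) <= e * rnorm h.
Proof.
split=> [dx|[D Dc H]].
- by exists ('d f x); [exact: diff_continuous|exact: differentiable_bound].
- have E : f \o shift x = cst (f x) + D +o_ 0 id.
    apply/eqaddoP => e e0.
    have ee : (rnorm (e : C R))%:C = e by rewrite -rnormE gtr0_norm.
    have e0' : 0 < rnorm (e : C R) by rewrite -ltcR ee.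
    have [d d0 dH] := H _ e0'; apply/nbhs_rnormP; exists d => // h; rewrite subr0 => hd.
    rewrite /= !rnormE -ee -rmorphM lecR /=.
    by have := dH h hd; rewrite opprD addrA [x + h]addrC; exact.
  have DE := diff_unique Dc E.
  by apply/diff_locallyP; rewrite DE.
Qed.

End RealNorm.

(** * Integrals of continuous functions over segments *)

Section Integral.
Context {R : realType}.
Notation mu := (@lebesgue_measure R).
Implicit Types (f g : R -> R) (a b c : R).

Definition rint f a b : R := (\int[mu]_(x in `[a, b]) f x)%R.

Lemma rint_integrable f a b : {in `[a, b], continuous f} ->
  mu.-integrable `[a, b] (EFin \o f).
Proof.
move=> fc; apply: continuous_compact_integrable; first exact: segment_compact.
by apply: continuous_in_subspaceT => x /set_mem xab; exact: fc.
Qed.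

Lemma eq_rint f g a b : (forall x, a <= x <= b -> f x = g x) -> rint f a b = rint g a b.
Proof. by move=> fg; apply: eq_Rintegral => x /set_mem/=; rewrite in_itv/= => /fg. Qed.

Lemma rint_split f a b c : a <= c <= b -> {in `[a, b], continuous f} ->
  rint f a b = rint f a c + rint f c b.
Proof.
move=> /andP[ac cb] fc; have fi := rint_integrable fc.
have := Rintegral_itvB fi (x := c); rewrite !bnd_simp => /(_ ac cb).
rewrite Rintegral_itv_obnd_cbnd; last first.
  apply: integrableS fi => //; apply: subset_itvr; by rewrite bnd_simp.
by move/eqP; rewrite subr_eq addrC => /eqP.
Qed.

Lemma rintB f g a b : {in `[a, b], continuous f} -> {in `[a, b], continuous g} ->
  rint (fun x => f x - g x) a b = rint f a b - rint g a b.
Proof. by move=> /rint_integrable fc /rint_integrable gc; exact: RintegralB. Qed.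

Lemma rintD f g a b : {in `[a, b], continuous f} -> {in `[a, b], continuous g} ->
  rint (fun x => f x + g x) a b = rint f a b + rint g a b.
Proof. by move=> /rint_integrable fc /rint_integrable gc; exact: RintegralD. Qed.

Lemma rint_cst k a b : a <= b -> rint (fun=> k) a b = k * (b - a).
Proof.
move=> ab; rewrite /rint Rintegral_cst//= lebesgue_measure_itv/= lte_fin.
case: ltP => //= ba; by rewrite (@le_anti _ _ a b) ?ab ?ba// subrr.
Qed.

Lemma rint_pt f a : rint f a a = 0.
Proof. by rewrite /rint set_itv1 Rintegral_set1. Qed.

Lemma rint_ge f a b k : a <= b -> {in `[a, b], continuous f} ->
  (forall x, a <= x <= b -> k <= f x) -> k * (b - a) <= rint f a b.
Proof.
move=> ab fc kf; rewrite -rint_cst//; apply: le_Rintegral => //.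
- by apply: rint_integrable => x _; exact: cvg_cst.
- exact: rint_integrable.
Qed.

Lemma rint_bound f a b k : a <= b -> {in `[a, b], continuous f} ->
  (forall x, a <= x <= b -> `|f x| <= k) -> `|rint f a b| <= k * (b - a).
Proof.
move=> ab fc kf; have fi := rint_integrable fc.
apply: le_trans (le_normr_Rintegral _ fi) _ => //.
rewrite -rint_cst//; apply: le_Rintegral => //.
- exact: (integrable_norm fi).
- by apply: rint_integrable => x _; exact: cvg_cst.
Qed.

End Integral.

(** * Contour integrals over rectangles *)

Section Contour.
Local Open Scope complex_scope.
Context {R : realType}.
Implicit Types (F G : C R -> C R) (x y : R).

(** The type is forced to [C R], which carries the topology. *)
Definition cplx x y : C R := x +i* y.

Lemma cplxE (z : C R) : z = cplx (complex.Re z) (complex.Im z).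
Proof. by case: z. Qed.

Lemma cplxB x y x' y' : cplx x y - cplx x' y' = cplx (x - x') (y - y').
Proof. by []. Qed.

Lemma rnorm_cplxl x x' y : rnorm (cplx x y - cplx x' y) = `|x - x'|.
Proof. by rewrite cplxB subrr; exact: rnorm_real. Qed.

Lemma rnorm_cplxr x y y' : rnorm (cplx x y - cplx x y') = `|y - y'|.
Proof.
rewrite cplxB subrr; apply/le_anti/andP; split; last exact: (rnorm_Im (cplx 0 (y - y'))).
by apply: le_trans (rnorm_le_ReIm _) _; rewrite /= normr0 add0r.
Qed.

Lemma continuous_lineP (f : R -> C R) (t : R) (z : C R) (F : C R -> C R) :
  f t = z -> (forall s, rnorm (f s - f t) = `|s - t|) -> {for z, continuous F} ->
  {for t, continuous (fun s => complex.Re (F (f s)))} /\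
  {for t, continuous (fun s => complex.Im (F (f s)))}.
Proof.
move=> <- fi /continuous_rnormP Fc.
split; apply/cvgrPdist_lt => e e0; have [d d0 dF] := Fc e e0;
  apply/nbhs_normP; exists d => // s sd;
  (have {}sd : rnorm (f s - f t) < d by rewrite fi distrC);
  apply: le_lt_trans (dF _ sd).
- by rewrite distrC -ReB; exact: rnorm_Re.
- by rewrite distrC -ImB; exact: rnorm_Im.
Qed.

Lemma continuous_cplxx F x y : {for cplx x y, continuous F} ->
  {for x, continuous (fun s => complex.Re (F (cplx s y)))} /\
  {for x, continuous (fun s => complex.Im (F (cplx s y)))}.
Proof. by apply: (@continuous_lineP (cplx^~ y)) => // s; exact: rnorm_cplxl. Qed.

Lemma continuous_cplxy F x y : {for cplx x y, continuous F} ->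
  {for y, continuous (fun s => complex.Re (F (cplx x s)))} /\
  {for y, continuous (fun s => complex.Im (F (cplx x s)))}.
Proof. by apply: (@continuous_lineP (cplx x)) => // s; exact: rnorm_cplxr. Qed.

(** The imaginary part of the integral of [F z dz] along the boundary of
a rectangle, with opposite sides grouped so that only integrals of real functions
of one real variable occur. The imaginary part is enough for Cauchy's estimate
since that of the integral of [1 / (z - b)] does not vanish. *)
Definition im_contour F x0 x1 y0 y1 : R :=
  rint (fun x => complex.Im (F (cplx x y0)) - complex.Im (F (cplx x y1))) x0 x1
  + rint (fun y => complex.Re (F (cplx x1 y)) - complex.Re (F (cplx x0 y))) y0 y1.

Definition rect_bdry x0 x1 y0 y1 : set (C R) := [set z |
  (x0 <= complex.Re z <= x1 /\ (complex.Im z = y0 \/ complex.Im z = y1)) \/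
  (y0 <= complex.Im z <= y1 /\ (complex.Re z = x0 \/ complex.Re z = x1))].

Definition rect x0 x1 y0 y1 : set (C R) := [set z |
  x0 <= complex.Re z <= x1 /\ y0 <= complex.Im z <= y1].

Lemma rect_bdry_sub x0 x1 y0 y1 : x0 <= x1 -> y0 <= y1 ->
  rect_bdry x0 x1 y0 y1 `<=` rect x0 x1 y0 y1.
Proof.
move=> x01 y01 z [[h [] e]|[h [] e]]; split=> //; by rewrite e lexx ?x01 ?y01.
Qed.

Lemma rectS x0 x1 y0 y1 x0' x1' y0' y1' : x0 <= x0' -> x1' <= x1 -> y0 <= y0' -> y1' <= y1 ->
  rect x0' x1' y0' y1' `<=` rect x0 x1 y0 y1.
Proof. by move=> ? ? ? ? z [/andP[? ?] /andP[? ?]]; split; lra. Qed.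

Lemma continuous_sub (f g : R -> R) (t : R) : {for t, continuous f} ->
  {for t, continuous g} -> {for t, continuous (fun x => f x - g x)}.
Proof. exact: (@cvgB _ _ _ _ _ f g). Qed.

Lemma continuous_in_sub (f g : R -> R) (a b : R) : {in `[a, b], continuous f} ->
  {in `[a, b], continuous g} -> {in `[a, b], continuous (fun x => f x - g x)}.
Proof. by move=> fc gc x xI; apply: continuous_sub; [exact: fc|exact: gc]. Qed.

Section Sides.
Variables (x0 x1 y0 y1 : R).
Hypotheses (x01 : x0 <= x1) (y01 : y0 <= y1).
Local Notation bd := (rect_bdry x0 x1 y0 y1).

Lemma continuous_on_sides F : (forall z, bd z -> {for z, continuous F}) ->
  [/\ {in `[x0, x1], continuous (fun x => complex.Im (F (cplx x y0)))},
      {in `[x0, x1], continuous (fun x => complex.Im (F (cplx x y1)))},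
      {in `[y0, y1], continuous (fun y => complex.Re (F (cplx x1 y)))} &
      {in `[y0, y1], continuous (fun y => complex.Re (F (cplx x0 y)))}].
Proof.
move=> Fc; split=> t; rewrite in_itv/= => tI.
- by apply: (proj2 (continuous_cplxx _)); apply: Fc; left; split => //; left.
- by apply: (proj2 (continuous_cplxx _)); apply: Fc; left; split => //; right.
- by apply: (proj1 (continuous_cplxy _)); apply: Fc; right; split => //; right.
- by apply: (proj1 (continuous_cplxy _)); apply: Fc; right; split => //; left.
Qed.

Lemma eq_im_contour F G : (forall z, bd z -> F z = G z) ->
  im_contour F x0 x1 y0 y1 = im_contour G x0 x1 y0 y1.
Proof.
move=> FG; congr (_ + _); apply: eq_rint => t tI; rewrite !FG//.
- by left; split=> //; right.
- by left; split=> //; left.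
- by right; split=> //; left.
- by right; split=> //; right.
Qed.

Lemma im_contourB F G : (forall z, bd z -> {for z, continuous F}) ->
  (forall z, bd z -> {for z, continuous G}) ->
  im_contour (fun z => F z - G z) x0 x1 y0 y1 =
  im_contour F x0 x1 y0 y1 - im_contour G x0 x1 y0 y1.
Proof.
move=> /continuous_on_sides[F1 F2 F3 F4] /continuous_on_sides[G1 G2 G3 G4].
rewrite /im_contour opprD addrACA; congr (_ + _); rewrite -rintB; do ?exact: continuous_in_sub;
  by apply: eq_rint => t _; rewrite ?ImB ?ReB; ring.
Qed.

Lemma im_contour_bound F (M : R) : (forall z, bd z -> {for z, continuous F}) ->
  (forall z, bd z -> rnorm (F z) <= M) ->
  `|im_contour F x0 x1 y0 y1| <= 2 * M * ((x1 - x0) + (y1 - y0)).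
Proof.
move=> Fc FM; have [F1 F2 F3 F4] := continuous_on_sides Fc.
apply: le_trans (ler_normD _ _) _; rewrite mulrDr; apply: lerD;
  (apply: rint_bound => //; first exact: continuous_in_sub) => t tI;
  apply: le_trans (ler_normB _ _) _; rewrite mulr2n mulrDl mul1r; apply: lerD.
- by apply: le_trans (rnorm_Im _) _; apply: FM; left; split=> //; left.
- by apply: le_trans (rnorm_Im _) _; apply: FM; left; split=> //; right.
- by apply: le_trans (rnorm_Re _) _; apply: FM; right; split=> //; right.
- by apply: le_trans (rnorm_Re _) _; apply: FM; right; split=> //; left.
Qed.

(** Only the slope contributes to the difference between opposite sides, and the
two pairs of sides contribute opposite multiples of the area. *)
Lemma im_contour_affine (a b : C R) : im_contour (fun z => a + b * z) x0 x1 y0 y1 = 0.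
Proof.
rewrite /im_contour.
rewrite [X in X + _](@eq_rint _ _ (fun=> complex.Re b * (y0 - y1))); last first.
  by move=> x _; case: a b => [a1 a2] [b1 b2] /=; ring.
rewrite [X in _ + X](@eq_rint _ _ (fun=> complex.Re b * (x1 - x0))); last first.
  by move=> x _; case: a b => [a1 a2] [b1 b2] /=; ring.
by rewrite !rint_cst//; ring.
Qed.

Lemma im_contour_splitx F c : x0 <= c <= x1 ->
  (forall z, rect x0 x1 y0 y1 z -> {for z, continuous F}) ->
  im_contour F x0 x1 y0 y1 = im_contour F x0 c y0 y1 + im_contour F c x1 y0 y1.
Proof.
move=> cI Fc; have Fcx t y : x0 <= t <= x1 -> y0 <= y <= y1 -> {for cplx t y, continuous F}.
  by move=> tI yI; exact: Fc.
rewrite /im_contour [in RHS]addrACA [X in X + _ = _](@rint_split _ _ x0 x1 c)//; last first.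
  move=> t; rewrite in_itv/= => tI.
  apply: continuous_sub; apply: (proj2 (continuous_cplxx _)); apply: Fcx => //;
    by rewrite lexx ?y01.
congr (_ + _); rewrite -rintD.
- by apply: eq_rint => t _; rewrite [RHS]addrC addrA subrK.
- move=> t; rewrite in_itv/= => tI.
  apply: continuous_sub; apply: (proj1 (continuous_cplxy _)); apply: Fcx => //;
    by rewrite lexx ?x01.
- move=> t; rewrite in_itv/= => tI.
  apply: continuous_sub; apply: (proj1 (continuous_cplxy _)); apply: Fcx => //;
    by rewrite lexx ?x01.
Qed.

Lemma im_contour_splity F c : y0 <= c <= y1 ->
  (forall z, rect x0 x1 y0 y1 z -> {for z, continuous F}) ->
  im_contour F x0 x1 y0 y1 = im_contour F x0 x1 y0 c + im_contour F x0 x1 c y1.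
Proof.
move=> cI Fc; have Fcx t y : x0 <= t <= x1 -> y0 <= y <= y1 -> {for cplx t y, continuous F}.
  by move=> tI yI; exact: Fc.
rewrite /im_contour [in RHS]addrACA [X in _ + X = _](@rint_split _ _ y0 y1 c)//; last first.
  move=> t; rewrite in_itv/= => tI.
  apply: continuous_sub; apply: (proj1 (continuous_cplxy _)); apply: Fcx => //;
    by rewrite lexx ?x01.
congr (_ + _); rewrite -rintD.
- by apply: eq_rint => t _; rewrite addrA subrK.
- move=> t; rewrite in_itv/= => tI.
  apply: continuous_sub; apply: (proj2 (continuous_cplxx _)); apply: Fcx => //;
    by rewrite lexx ?y01.
- move=> t; rewrite in_itv/= => tI.
  apply: continuous_sub; apply: (proj2 (continuous_cplxx _)); apply: Fcx => //;
    by rewrite lexx ?y01.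
Qed.

End Sides.

Lemma im_contour_degx F x y0 y1 : im_contour F x x y0 y1 = 0.
Proof.
rewrite /im_contour rint_pt add0r (@eq_rint _ _ (fun=> 0)); last by move=> *; rewrite subrr.
by rewrite /rint Rintegral_cst//= mul0r.
Qed.

Lemma im_contour_degy F x0 x1 y : im_contour F x0 x1 y y = 0.
Proof.
rewrite /im_contour rint_pt addr0 (@eq_rint _ _ (fun=> 0)); last by move=> *; rewrite subrr.
by rewrite /rint Rintegral_cst//= mul0r.
Qed.

End Contour.

(** * Goursat's lemma *)

Section Goursat.
Context {R : realType}.
Implicit Types (F G : C R -> C R) (x y : R).

(** The form of differentiability that the bisection argument consumes. *)
Lemma derivable_rnorm F (p : C R) : derivable F p 1 -> exists c : C R,
  forall e : R, 0 < e -> exists2 d : R, 0 < d &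
    forall z, rnorm (z - p) < d -> rnorm (F z - F p - c * (z - p)) <= e * rnorm (z - p).
Proof.
move=> /derivable1_diffP/differentiable_rnormP[D _ DF]; exists (D 1) => e /DF[d d0 dF].
exists d => // z /dF; rewrite addrCA subrr addr0.
have -> : D (z - p) = D 1 * (z - p) by rewrite -{1}[z - p]mulr1 linearZ /= mulrC.
exact.
Qed.

Lemma derivable_continuous F (p : C R) : derivable F p 1 -> {for p, continuous F}.
Proof. by move=> /derivable1_diffP; exact: differentiable_continuous. Qed.

(** The bookkeeping of the bisection, one coordinate at a time. *)
Lemma half_step (x x' s lo hi : R) : 0 <= s -> x' = x \/ x' = x + s / 2 ->
  lo <= x -> x + s <= hi ->
  [/\ x <= x', x' + s / 2 <= x + s, lo <= x' & x' + s / 2 <= hi].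
Proof. by move=> s0 [] -> lx xh; split; lra. Qed.

Lemma continuous_subC F G z : {for z, continuous F} -> {for z, continuous G} ->
  {for z, continuous (fun z => F z - G z)}.
Proof. by move=> Fc Gc; exact: (@cvgB (C R) (C R) _ _ _ F G _ _ Fc Gc). Qed.

Lemma continuous_addC F G z : {for z, continuous F} -> {for z, continuous G} ->
  {for z, continuous (fun z => F z + G z)}.
Proof. by move=> Fc Gc; exact: (@cvgD (C R) (C R) _ _ _ F G _ _ Fc Gc). Qed.

Lemma continuous_mulC F G z : {for z, continuous F} -> {for z, continuous G} ->
  {for z, continuous (fun z => F z * G z)}.
Proof. exact: continuousM. Qed.

Lemma continuous_affine (a b z : C R) : {for z, continuous (fun z : C R => a + b * z)}.
Proof.
apply: continuous_addC; first exact: cst_continuous.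
by apply: continuous_mulC; [exact: cst_continuous|exact: cvg_id].
Qed.

Lemma distance_in_itv (lo z p s : R) :
  lo <= z -> z <= lo + s -> lo <= p <= lo + s -> `|z - p| <= s.
Proof. by move=> ? ? /andP[? ?]; rewrite ler_norml; apply/andP; split; lra. Qed.

(** The four quarters add up to the rectangle, so one of them carries at least
a quarter of its integral. *)
Lemma im_contour_quarter F x0 y0 (a b : R) : 0 <= a -> 0 <= b ->
  (forall z, rect x0 (x0 + a) y0 (y0 + b) z -> {for z, continuous F}) ->
  exists x y, [/\ x = x0 \/ x = x0 + a / 2, y = y0 \/ y = y0 + b / 2 &
    `|im_contour F x0 (x0 + a) y0 (y0 + b)| <=
      4 * `|im_contour F x (x + a / 2) y (y + b / 2)| ].
Proof.
move=> a0 b0 Fc.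
have [[ha hb] [hc hd]] : (x0 <= x0 + a / 2 /\ x0 + a / 2 <= x0 + a) /\
   (y0 <= y0 + b / 2 /\ y0 + b / 2 <= y0 + b) by split; split; lra.
have Ea : x0 + a / 2 + a / 2 = x0 + a by lra.
have Eb : y0 + b / 2 + b / 2 = y0 + b by lra.
rewrite (im_contour_splitx _ _ (c := x0 + a / 2)) ?ha ?hb//; [|lra|lra].
rewrite (im_contour_splity _ _ (x0 := x0) (c := y0 + b / 2)) ?hc ?hd//; [|lra|]; last first.
  by move=> z /rectS zr; apply: Fc; apply: zr; lra.
rewrite (im_contour_splity _ _ (x0 := x0 + a / 2) (c := y0 + b / 2)) ?hc ?hd//;
  [|lra|]; last first.
  by move=> z /rectS zr; apply: Fc; apply: zr; lra.
set A := im_contour _ _ _ _ _; set B := im_contour _ _ _ _ _.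
set A' := im_contour _ _ _ _ _; set B' := im_contour _ _ _ _ _.
have : `|A + B + (A' + B')| <= `|A| + `|B| + (`|A'| + `|B'|).
  by apply: le_trans (ler_normD _ _) _; apply: lerD; exact: ler_normD.
move=> H.
have [h1|h1] := leP `|A + B + (A' + B')| (4 * `|A|).
  by exists x0, y0; split; [left|left|].
have [h2|h2] := leP `|A + B + (A' + B')| (4 * `|B|).
  by exists x0, (y0 + b / 2); split; [left|right|rewrite Eb].
have [h3|h3] := leP `|A + B + (A' + B')| (4 * `|A'|).
  by exists (x0 + a / 2), y0; split; [right|left|rewrite Ea].
exists (x0 + a / 2), (y0 + b / 2); split; [by right|by right|rewrite Ea Eb].
rewrite -/B'; move: H h1 h2 h3; clear; lra.
Qed.

Lemma half_expn_small (k d : R) : 0 < d -> exists n : nat, k * 2^-1 ^+ n < d.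
Proof.
move=> d0; have [k0|k0] := leP k 0.
  by exists 0%N; rewrite expr0 mulr1 (le_lt_trans k0).
have := @near_infty_natSinv_expn_lt R (PosNum (divr_gt0 d0 k0)).
move=> [N _ /(_ N (leqnn _))]; rewrite /= => h; exists N.
rewrite mulrC -ltr_pdivlMr// exprVn; move: h; rewrite div1r//.
Qed.

Lemma four_half_expn n : 4 ^+ n * (2^-1 ^+ n * 2^-1 ^+ n) = 1 :> R.
Proof.
rewrite -exprMn -exprMn (_ : 4 * _ = 1) ?expr1n//; lra.
Qed.

Lemma small_ratio (S c : R) : 0 <= S -> 0 < c -> 2 * (c / (4 * (S + 1))) * S < c.
Proof.
move=> S0 c0.
have S1 : 0 < S + 1 by lra.
rewrite (_ : 2 * _ * S = c * S / (2 * (S + 1))); last by field; rewrite gt_eqF.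
rewrite ltr_pdivrMr ?mulr_gt0//; nra.
Qed.

(** Bisection produces nested rectangles of sides [2 ^ - n] whose integrals are at
least [4 ^ - n] times the original one. At their common point [F] is affine up
to [o(|z - p|)]; affine functions integrate to zero and the error contributes
[o(4 ^ - n)]. Nothing is asked of the derivative beyond existence. *)
Lemma goursat F x0 x1 y0 y1 : x0 <= x1 -> y0 <= y1 ->
  (forall z, rect x0 x1 y0 y1 z -> derivable F z 1) -> im_contour F x0 x1 y0 y1 = 0.
Proof.
move=> x01 y01 dF.
have Fc z : rect x0 x1 y0 y1 z -> {for z, continuous F}.
  by move=> /dF; exact: derivable_continuous.
apply/eqP/contraT; rewrite -normr_gt0; set c := `|_| => c0.
have [a Ea] : exists a, a = x1 - x0 by eexists.
have [b Eb] : exists b, b = y1 - y0 by eexists.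
have a0 : 0 <= a by rewrite Ea subr_ge0.
have b0 : 0 <= b by rewrite Eb subr_ge0.
pose w n : R := 2^-1 ^+ n.
have w0 n : 0 < w n by rewrite exprn_gt0// invr_gt0.
have wS n : w n.+1 = w n / 2 by rewrite /w exprSr.
pose good (p : nat * (R * R)) := let: (n, (x, y)) := p in
  [/\ x0 <= x, x + a * w n <= x1, y0 <= y, y + b * w n <= y1 &
  c <= 4 ^+ n * `|im_contour F x (x + a * w n) y (y + b * w n)| ].
(* [rel] preserves [good] instead of requiring it, so that it is total and
   dependent choice applies. *)
pose rel (p q : nat * (R * R)) := let: (n, (x, y)) := p in let: (m, (x', y')) := q in
  [/\ m = n.+1, good p -> good q,
    x <= x' /\ x' + a * w m <= x + a * w n &
    y <= y' /\ y' + b * w m <= y + b * w n].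
have aw n : 0 <= a * w n by rewrite mulr_ge0// ltW.
have bw n : 0 <= b * w n by rewrite mulr_ge0// ltW.
have step p : {q | rel p q}.
  apply: cid; case: p => n [x y].
  have aS : a * w n.+1 = a * w n / 2 by rewrite wS mulrA.
  have bS : b * w n.+1 = b * w n / 2 by rewrite wS mulrA.
  have [gp|ngp] := pselect (good (n, (x, y))); last first.
    exists (n.+1, (x, y)); split => //; rewrite ?aS ?bS; split=> //.
    - by rewrite lerD2l ler_piMr// invf_le1// ler1n.
    - by rewrite lerD2l ler_piMr// invf_le1// ler1n.
  have [g1 g2 g3 g4 g5] := gp.
  have [|x' [y' [hx hy h]]] := im_contour_quarter (aw n) (bw n) (F := F) (x0 := x) (y0 := y).
    by move=> z /rectS zr; apply: Fc; exact: zr.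
  have [hx1 hx2 hx3 hx4] := half_step (aw n) hx g1 g2.
  have [hy1 hy2 hy3 hy4] := half_step (bw n) hy g3 g4.
  exists (n.+1, (x', y')); split=> //; rewrite ?aS ?bS//.
  move=> _; rewrite /good ?aS ?bS; split=> //.
  - apply: (le_trans g5); rewrite exprSr -mulrA ler_wpM2l//.
have [f [f0 fS]] := dependent_choice step (0%N, (x0, y0)).
have f1 n : (f n).1 = n.
  elim: n => [|n IH]; first by rewrite f0.
  have := fS n; case: (f n) IH => [k [x y]] /= ->.
  by case: (f n.+1) => [m [x' y']] [].
have fg n : good (f n).
  elim: n => [|n IH].
    rewrite f0 /good /w !expr0 mul1r !mulr1; rewrite Ea Eb !subrKC; split; exact: lexx.
  have := fS n; case: (f n) IH => [k [x y]].
  by case: (f n.+1) => [m [x' y']] gp [_ /(_ gp)].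
pose X n := (f n).2.1; pose Y n := (f n).2.2.
have XYS n : [/\ X n <= X n.+1, X n.+1 + a * w n.+1 <= X n + a * w n,
   Y n <= Y n.+1 & Y n.+1 + b * w n.+1 <= Y n + b * w n].
  have := fS n; have := f1 n; have := f1 n.+1; rewrite /X /Y.
  case: (f n) => [k [x y]]; case: (f n.+1) => [m [x' y']] /= -> ->.
  by case=> _ _ [? ?] [? ?].
have XYg n : [/\ x0 <= X n, X n + a * w n <= x1, y0 <= Y n, Y n + b * w n <= y1 &
  c <= 4 ^+ n * `|im_contour F (X n) (X n + a * w n) (Y n) (Y n + b * w n)| ].
  have := fg n; have := f1 n; rewrite /X /Y.
  by case: (f n) => [k [x y]] /= ->.
(* Nested segments have a common point. *)
have mono (Z : nat -> R) (k : R) : (forall n, Z n <= Z n.+1) ->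
    (forall n, Z n.+1 + k * w n.+1 <= Z n + k * w n) -> 0 <= k ->
    exists s, forall n, Z n <= s <= Z n + k * w n.
  move=> Zm Zw k0.
  have Zmn m n : Z n <= Z m + k * w m.
    have kw i : 0 <= k * w i by rewrite mulr_ge0// ltW.
    have H1 i : Z n <= Z (n + i)%N.
      by elim: i => [|i IH]; rewrite ?addn0// addnS (le_trans IH).
    have H2 i : Z (m + i)%N + k * w (m + i)%N <= Z m + k * w m.
      by elim: i => [|i IH]; rewrite ?addn0// addnS (le_trans _ IH).
    apply: le_trans (H1 m) (le_trans _ (H2 n)); rewrite addnC.
    by rewrite lerDl.
  have Zub m : ubound (range Z) (Z m + k * w m) by move=> _ [n _ <-].
  exists (sup (range Z)) => n; apply/andP; split.
    by apply: ub_le_sup; [exists (Z 0%N + k * w 0%N)|exists n].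
  by apply: ge_sup => //; exists (Z 0%N), 0%N.
have [px hx] := mono X a (fun n => let: And4 h _ _ _ := XYS n in h)
  (fun n => let: And4 _ h _ _ := XYS n in h) a0.
have [py hy] := mono Y b (fun n => let: And4 _ _ h _ := XYS n in h)
  (fun n => let: And4 _ _ _ h := XYS n in h) b0.
pose p := cplx px py.
have pr : rect x0 x1 y0 y1 p.
  have [] := XYg 0%N; have := hx 0%N; have := hy 0%N.
  rewrite /rect/= => /andP[p1 p2] /andP[p3 p4] p5 p6 p7 p8 _.
  by move: p1 p2 p3 p4 p5 p6 p7 p8; clear => *; split; lra.
have [k kF] := derivable_rnorm (dF _ pr).
pose S := (a + b) ^+ 2.
have S0 : 0 <= S by rewrite exprn_ge0// addr_ge0.
pose e := c / (4 * (S + 1)).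
have e0 : 0 < e by rewrite divr_gt0// mulr_gt0// ltr_wpDl.
have [d d0 dk] := kF e e0.
have [n nd] := half_expn_small (a + b) d0.
have [g1 g2 g3 g4 g5] := XYg n.
have xle : X n <= X n + a * w n by rewrite lerDl.
have yle : Y n <= Y n + b * w n by rewrite lerDl.
pose bd := rect_bdry (X n) (X n + a * w n) (Y n) (Y n + b * w n).
have bdr z : bd z -> rect (X n) (X n + a * w n) (Y n) (Y n + b * w n) z by exact: rect_bdry_sub.
have bdc z : bd z -> {for z, continuous F}.
  by move=> /bdr /rectS h; apply: Fc; exact: h.
have bdA z : bd z -> {for z, continuous (fun z => (F p - k * p) + k * z)}.
  by move=> _; exact: continuous_affine.
have bdk z : bd z -> rnorm (F z - ((F p - k * p) + k * z)) <= e * ((a + b) * w n).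
  move=> /bdr[/andP[r1 r2] /andP[r3 r4]].
  have zp : rnorm (z - p) <= (a + b) * w n.
    apply: le_trans (rnorm_le_ReIm _) _; rewrite ReB ImB /= mulrDl.
    by apply: lerD; [exact: distance_in_itv r1 r2 (hx n)|exact: distance_in_itv r3 r4 (hy n)].
  have -> : F z - (F p - k * p + k * z) = F z - F p - k * (z - p) by ring.
  apply: le_trans (dk z (le_lt_trans zp nd)) _.
  by rewrite ler_wpM2l// ltW.
have bdB z : bd z -> {for z, continuous (fun z => F z - ((F p - k * p) + k * z))}.
  by move=> zb; apply: continuous_subC; [exact: bdc|exact: bdA].
have := im_contour_bound xle yle bdB bdk.
rewrite (im_contourB bdc bdA) im_contour_affine ?subr0 // => H.
have E : X n + a * w n - X n + (Y n + b * w n - Y n) = (a + b) * w n by ring.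
rewrite E in H.
have w4 : 4 ^+ n * (w n * w n) = 1 by exact: four_half_expn.
have : c <= 2 * e * S.
  apply: le_trans g5 _.
  apply: (@le_trans _ _ (4 ^+ n * (2 * (e * ((a + b) * w n)) * ((a + b) * w n)))).
    by rewrite ler_wpM2l// exprn_ge0.
  have -> : 4 ^+ n * (2 * (e * ((a + b) * w n)) * ((a + b) * w n)) =
     4 ^+ n * (w n * w n) * (2 * e * S) by rewrite /S; ring.
  by rewrite w4 mul1r.
by move=> cS; have := small_ratio S0 c0; rewrite ltNge -/e cS.
Qed.

Lemma im_contour_small F (M d a b c1 c2 : R) :
  a <= b -> c1 <= c2 -> b - a <= d -> c2 - c1 <= d -> 0 <= M ->
  (forall z, rect a b c1 c2 z -> {for z, continuous F}) ->
  (forall z, rect a b c1 c2 z -> rnorm (F z) <= M) -> `|im_contour F a b c1 c2| <= 4 * M * d.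
Proof.
move=> ab cc abd ccd M0 Fc FM.
have H z : rect_bdry a b c1 c2 z -> rect a b c1 c2 z by exact: rect_bdry_sub.
apply: le_trans (im_contour_bound ab cc (fun z zb => Fc z (H z zb))
  (fun z zb => FM z (H z zb))) _.
nra.
Qed.

(** An exceptional point where [F] is continuous is enclosed in a small rectangle,
whose integral is small by boundedness; cutting along its sides leaves pieces
that avoid the point. Needed because divided differences are only continuous at
their base points. *)
Lemma goursat_except F (s : seq (C R)) x0 x1 y0 y1 : x0 <= x1 -> y0 <= y1 ->
  (forall z, rect x0 x1 y0 y1 z -> {for z, continuous F}) ->
  (forall z, rect x0 x1 y0 y1 z -> z \notin s -> derivable F z 1) ->
  im_contour F x0 x1 y0 y1 = 0.
Proof.
elim: s x0 x1 y0 y1 => [|e s IH] x0 x1 y0 y1 x01 y01 Fc dF.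
  by apply: (goursat x01 y01) => z zr; exact: (dF z zr).
have off a b c1 c2 : x0 <= a -> b <= x1 -> y0 <= c1 -> c2 <= y1 -> a <= b -> c1 <= c2 ->
    ~ rect a b c1 c2 e -> im_contour F a b c1 c2 = 0.
  move=> h1 h2 h3 h4 ab cc ne; have sub := rectS h1 h2 h3 h4; apply: (IH _ _ _ _ ab cc).
  - by move=> z /sub; exact: Fc.
  - move=> z zr zs; apply: dF; first exact: sub.
    rewrite inE negb_or zs andbT; apply/eqP => ze; apply: ne; by rewrite -ze.
have [re|] := pselect (rect x0 x1 y0 y1 e); last by apply: off => //; exact: lexx.
have [/andP[e1 e2] /andP[e3 e4]] := re.
have /continuous_rnormP /(_ 1 ltr01)[r r0 Fr] := Fc _ re.
(* [M] bounds [F] near [e], by continuity. *)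
pose M := rnorm (F e) + 1.
have M0 : 0 <= M by rewrite addr_ge0// rnorm_ge0.
have FM z : rnorm (z - e) < r -> rnorm (F z) <= M.
  move=> /Fr zr; rewrite -[F z](subrK (F e)) addrC; apply: le_trans (rnormD _ _) _.
  by rewrite lerD2l ltW.
have key d : 0 < d -> d < r / 2 -> `|im_contour F x0 x1 y0 y1| <= 4 * M * (2 * d).
  move=> d0 dr.
  (* The small rectangle is truncated where it leaves the large one; the first
     alternative in [a3], ..., [h3] is a truncation, with a degenerate strip beyond. *)
  have [a [a1 a2 a4 a3]] :
      exists a, [/\ x0 <= a, a <= complex.Re e, complex.Re e - d <= a & a = x0 \/ a = complex.Re e - d].
    have [h|h] := leP x0 (complex.Re e - d).
      by exists (complex.Re e - d); split; [|lra|exact: lexx|right].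
    by exists x0; split; [exact: lexx| |exact: ltW|left].
  have [b [b1 b2 b4 b3]] :
      exists b, [/\ b <= x1, complex.Re e <= b, b <= complex.Re e + d & b = x1 \/ b = complex.Re e + d].
    have [h|h] := leP (complex.Re e + d) x1.
      by exists (complex.Re e + d); split; [|lra|exact: lexx|right].
    by exists x1; split; [exact: lexx| |exact: ltW|left].
  have [g [g1 g2 g4 g3]] :
      exists g, [/\ y0 <= g, g <= complex.Im e, complex.Im e - d <= g & g = y0 \/ g = complex.Im e - d].
    have [h|h] := leP y0 (complex.Im e - d).
      by exists (complex.Im e - d); split; [|lra|exact: lexx|right].
    by exists y0; split; [exact: lexx| |exact: ltW|left].
  have [h [h1 h2 h4 h3]] :
      exists h, [/\ h <= y1, complex.Im e <= h, h <= complex.Im e + d & h = y1 \/ h = complex.Im e + d].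
    have [h|h] := leP (complex.Im e + d) y1.
      by exists (complex.Im e + d); split; [|lra|exact: lexx|right].
    by exists y1; split; [exact: lexx| |exact: ltW|left].
  have ab : a <= b by exact: le_trans a2 b2.
  have gh : g <= h by exact: le_trans g2 h2.
  have ax : a <= x1 by exact: le_trans a2 e2.
  have bx : x0 <= b by exact: le_trans e1 b2.
  have gy : g <= y1 by exact: le_trans g2 e4.
  have hy : y0 <= h by exact: le_trans e3 h2.
  have Fab z : rect a b y0 y1 z -> {for z, continuous F}.
    by move=> zr; apply: Fc; apply: rectS zr.
  rewrite (im_contour_splitx x01 y01 _ Fc (c := a)) ?a1 ?ax//.
  rewrite [X in X + _](_ : _ = 0); last first.
    case: a3 => [->|ae]; first exact: im_contour_degx.
    by apply: off => //; rewrite /rect/= ae => -[/andP[+ +] _]; move: d0; clear; lra.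
  rewrite (im_contour_splitx ax y01 (c := b)) ?ab ?b1//; last first.
    by move=> z zr; apply: Fc; apply: rectS zr.
  rewrite [X in _ + (_ + X)](_ : _ = 0); last first.
    case: b3 => [->|be]; first exact: im_contour_degx.
    by apply: off => //; rewrite /rect/= be => -[/andP[+ +] _]; move: d0; clear; lra.
  rewrite (im_contour_splity ab y01 (c := g)) ?g1 ?gy//.
  rewrite [X in _ + (X + _ + _)](_ : _ = 0); last first.
    case: g3 => [->|ge]; first exact: im_contour_degy.
    by apply: off => //; rewrite /rect/= ge => -[_ /andP[+ +]]; move: d0; clear; lra.
  rewrite (im_contour_splity ab gy (c := h)) ?gh ?h1//; last first.
    by move=> z zr; apply: Fc; apply: rectS zr.
  rewrite [X in _ + (_ + (_ + X) + _)](_ : _ = 0); last first.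
    case: h3 => [->|he]; first exact: im_contour_degy.
    by apply: off => //; rewrite /rect/= he => -[_ /andP[+ +]]; move: d0; clear; lra.
  rewrite !add0r !addr0.
  have ba : b - a <= 2 * d by move: a4 b4; clear; lra.
  have hg : h - g <= 2 * d by move: g4 h4; clear; lra.
  apply: im_contour_small => //.
  - by move=> z zr; apply: Fc; apply: rectS zr.
  - move=> z [/andP[z1 z2] /andP[z3 z4]]; apply: FM.
    apply: le_lt_trans (rnorm_le_ReIm _) _; rewrite ReB ImB.
    have : `|complex.Re z - complex.Re e| <= d.
      by rewrite ler_norml; move: z1 z2 a4 b4; clear => *; apply/andP; split; lra.
    have : `|complex.Im z - complex.Im e| <= d.
      by rewrite ler_norml; move: z3 z4 g4 h4; clear => *; apply/andP; split; lra.
    by move: dr; clear; lra.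
apply/eqP; rewrite -normr_le0; apply/ler_addgt0Pr => t t0; rewrite add0r.
pose d := Num.min (r / 4) (t / (8 * (M + 1))).
have M1 : 0 < 8 * (M + 1) by lra.
have d0 : 0 < d by rewrite lt_min !divr_gt0.
have dr : d < r / 2 by rewrite gt_min; apply/orP; left; lra.
apply: le_trans (key d d0 dr) _.
have : d <= t / (8 * (M + 1)) by rewrite ge_min lexx orbT.
rewrite ler_pdivlMr//; nra.
Qed.

End Goursat.

(** * Cauchy's estimate at the centre of a square *)

Section Cauchy.
Context {R : realType}.
Implicit Types (F G : C R -> C R) (x y : R).

(** The divided difference of [F] based at [b]; the value [c] at [b] itself is
a parameter, to be chosen so as to make it continuous. *)
Definition slope (c : C R) F (b z : C R) : C R :=
  if z == b then c else (F z - F b) / (z - b).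

Lemma slope_neq c F (b z : C R) : z != b -> slope c F b z = (F z - F b) / (z - b).
Proof. by rewrite /slope => /negPf ->. Qed.

Lemma slope_exists F (b : C R) : derivable F b 1 ->
  exists c, {for b, continuous (slope c F b)}.
Proof.
move=> /derivable_rnorm[c cF]; exists c; apply/continuous_rnormP => e e0.
have e2 : 0 < e / 2 by lra.
have [d d0 dF] := cF (e / 2) e2.
exists d => // z zd; rewrite {2}/slope eqxx /slope.
case: (eqVneq (z : C R) b) => [_|zb]; first by rewrite subrr rnorm0.
have zb0 : z - b != 0 by rewrite subr_eq0.
have -> : (F z - F b) / (z - b) - c = (F z - F b - c * (z - b)) / (z - b) by field.
rewrite rnormM rnormV; have nb : 0 < rnorm (z - b) by rewrite rnorm_gt0.
rewrite ltr_pdivrMr//; apply: le_lt_trans (dF z zd) _.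
by rewrite ltr_pM2r//; lra.
Qed.

Lemma near_neq (b z : C R) : z != b -> \forall w \near z, w != b.
Proof.
move=> zb; apply/nbhs_rnormP; exists (rnorm (z - b)); first by rewrite rnorm_gt0 subr_eq0.
by move=> w; apply: contraTneq => ->; rewrite rnorm_distC ltxx.
Qed.

Lemma derivable_inv_sub (b z : C R) : z != b -> derivable (fun z : C R => (z - b)^-1) z 1.
Proof.
move=> zb; apply: derivableV; first by rewrite subr_eq0.
by apply: derivableB; [exact: derivable_id|exact: derivable_cst].
Qed.

Lemma derivable_slope c F (b z : C R) : z != b -> derivable F z 1 ->
  derivable (slope c F b) z 1.
Proof.
move=> zb dF.
apply: (@near_eq_derivable _ _ _ (fun z => (F z - F b) * (z - b)^-1)).
- by apply: filterS (near_neq zb) => w wb; rewrite slope_neq.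
- apply: derivableM; last exact: derivable_inv_sub.
  by apply: derivableB; [exact: dF|exact: derivable_cst].
Qed.

Lemma continuous_near F G (z : C R) : (\forall w \near z, F w = G w) ->
  {for z, continuous F} -> {for z, continuous G}.
Proof.
move=> FG Fc; rewrite /prop_for /continuous_at -(nbhs_singleton FG).
exact: cvg_trans (near_eq_cvg FG) Fc.
Qed.

Lemma continuous_slope c F (b z : C R) : z != b -> {for z, continuous F} ->
  {for z, continuous (slope c F b)}.
Proof.
move=> zb Fc.
apply: (@continuous_near (fun z => (F z - F b) * (z - b)^-1)).
  by apply: filterS (near_neq zb) => w wb; rewrite slope_neq.
apply: continuous_mulC.
  by apply: continuous_subC; [exact: Fc|exact: cst_continuous].
by apply: derivable_continuous; exact: derivable_inv_sub.
Qed.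

Lemma Re_inv (z : C R) :
  complex.Re (z^-1) = complex.Re z / (complex.Re z ^+ 2 + complex.Im z ^+ 2).
Proof. by case: z. Qed.
Lemma Im_inv (z : C R) :
  complex.Im (z^-1) = - complex.Im z / (complex.Re z ^+ 2 + complex.Im z ^+ 2).
Proof. by case: z => a b; rewrite mulNr. Qed.

Definition square (b : C R) (r : R) :=
  rect (complex.Re b - r) (complex.Re b + r)
    (complex.Im b - r) (complex.Im b + r).
Definition square_bdry (b : C R) (r : R) :=
  rect_bdry (complex.Re b - r) (complex.Re b + r)
    (complex.Im b - r) (complex.Im b + r).
Definition im_contour_square F (b : C R) (r : R) :=
  im_contour F (complex.Re b - r) (complex.Re b + r)
    (complex.Im b - r) (complex.Im b + r).

Lemma square_rnorm b r z : square b r z -> rnorm (z - b) <= 2 * r.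
Proof.
move=> [/andP[h1 h2] /andP[h3 h4]]; apply: le_trans (rnorm_le_ReIm _) _.
rewrite ReB ImB mulr2n mulrDl mul1r; apply: lerD; rewrite ler_norml; apply/andP; split; lra.
Qed.

Lemma square_bdry_rnorm b r z : 0 < r -> square_bdry b r z -> r <= rnorm (z - b).
Proof.
move=> r0 [[_ [] h]|[_ [] h]].
- by apply: le_trans (rnorm_Im _); rewrite ImB h addrAC subrr add0r normrN ler_norm.
- by apply: le_trans (rnorm_Im _); rewrite ImB h addrAC subrr add0r ler_norm.
- by apply: le_trans (rnorm_Re _); rewrite ReB h addrAC subrr add0r normrN ler_norm.
- by apply: le_trans (rnorm_Re _); rewrite ReB h addrAC subrr add0r ler_norm.
Qed.

Lemma square_bdry_sub b r z : 0 < r -> square_bdry b r z -> square b r z.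
Proof. by move=> r0; apply: rect_bdry_sub; lra. Qed.

Lemma square_bdry_nonempty b r : 0 < r -> exists z, square_bdry b r z.
Proof.
move=> r0; exists (cplx (complex.Re b) (complex.Im b - r)).
by left; split; [apply/andP; split => /=; lra|left].
Qed.

(** The imaginary part of [dz / (z - b)] on a pair of opposite sides. *)
Lemma kernel_lower (r t : R) : 0 < r -> - r <= t <= r ->
  r^-1 <= r / (t ^+ 2 + r ^+ 2) + r / (t ^+ 2 + r ^+ 2).
Proof.
move=> r0 /andP[t1 t2]; have n0 : 0 < t ^+ 2 + r ^+ 2 by nra.
rewrite -mulrDl ler_pdivlMr// -(ler_pM2l r0) mulrA mulfV ?gt_eqF// mul1r; nra.
Qed.

(** The exact value is [2 * pi], but a crude bound for the kernel on each pair of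
sides suffices. *)
Lemma im_contour_inv (b : C R) (r : R) : 0 < r ->
  4 <= im_contour_square (fun z => (z - b)^-1) b r.
Proof.
move=> r0.
have bc z : square_bdry b r z -> {for z, continuous (fun z : C R => (z - b)^-1)}.
  move=> zb; apply: derivable_continuous; apply: derivable_inv_sub.
  by rewrite -subr_eq0 -rnorm_gt0 (lt_le_trans r0)// square_bdry_rnorm.
have [F1 F2 F3 F4] := continuous_on_sides bc.
rewrite /im_contour_square /im_contour.
have -> : (4 : R) = 2 + 2 by lra.
apply: lerD.
- have -> : (2 : R) = r^-1 * ((complex.Re b + r) - (complex.Re b - r)).
    by field; rewrite gt_eqF.
  apply: rint_ge; [lra|exact: continuous_in_sub|].
  move=> x /andP[x1 x2]; rewrite !Im_inv !ReB !ImB /=.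
  rewrite (_ : - (complex.Im b - r - complex.Im b) = r); last by ring.
  rewrite (_ : complex.Im b - r - complex.Im b = - r); last by ring.
  rewrite (_ : complex.Im b + r - complex.Im b = r); last by ring.
  rewrite sqrrN mulNr opprK; apply: kernel_lower => //; apply/andP; split; lra.
- have -> : (2 : R) = r^-1 * ((complex.Im b + r) - (complex.Im b - r)).
    by field; rewrite gt_eqF.
  apply: rint_ge; [lra|exact: continuous_in_sub|].
  move=> x /andP[x1 x2]; rewrite !Re_inv !ReB !ImB /=.
  rewrite (_ : complex.Re b - r - complex.Re b = - r); last by ring.
  rewrite (_ : complex.Re b + r - complex.Re b = r); last by ring.
  rewrite sqrrN mulNr opprK addrC; rewrite ![r ^+ 2 + _]addrC.
  by apply: kernel_lower => //; apply/andP; split; lra.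
Qed.

(** After scaling [F] so that [F b = 1], write
[F z / (z - b) = 1 / (z - b) + (F z - 1) / (z - b)]. The last term is a divided
difference, with vanishing integral, the next to last integrates to at least 4,
and the left-hand side to at most [8 * M]. *)
Lemma cauchy_center_bound F (s : seq (C R)) (b : C R) (r M : R) : 0 < r ->
  (forall z, square b r z -> {for z, continuous F}) ->
  (forall z, square b r z -> z \notin s -> derivable F z 1) ->
  derivable F b 1 ->
  (forall z, square_bdry b r z -> rnorm (F z) <= M) -> rnorm (F b) <= 2 * M.
Proof.
move=> r0 Fc dF dFb FM.
have [z0 z0b] := square_bdry_nonempty b r0.
have M0 : 0 <= M by apply: le_trans (FM _ z0b); exact: rnorm_ge0.
have [Fb0|Fb0] := eqVneq (F b) 0; first by rewrite Fb0 rnorm0; lra.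
pose G z := (F b)^-1 * F z.
have Gc z : {for z, continuous F} -> {for z, continuous G}.
  by move=> Fz; apply: continuous_mulC; [exact: cst_continuous|exact: Fz].
have dG z : derivable F z 1 -> derivable G z 1.
  by move=> Fz; apply: derivableM; [exact: derivable_cst|exact: Fz].
have Gb : G b = 1 by rewrite /G mulVf.
have [c cc] := slope_exists (dG _ dFb).
have zb z : square_bdry b r z -> z != b.
  by move=> zb; rewrite -subr_eq0 -rnorm_gt0 (lt_le_trans r0)// square_bdry_rnorm.
have Sc z : square b r z -> {for z, continuous (slope c G b)}.
  move=> zs; have [->|zn] := eqVneq z b; first exact: cc.
  by have := @continuous_slope c G b z zn; apply; apply: Gc; exact: Fc.
have S0 : im_contour_square (slope c G b) b r = 0.
  apply: (@goursat_except _ _ (b :: s)); [lra|lra|exact: Sc|].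
  move=> z zs; rewrite inE negb_or => /andP[zn zns].
  by have := @derivable_slope c G b z zn; apply; apply: dG; exact: dF.
pose H z := G z * (z - b)^-1.
have Hc z : square_bdry b r z -> {for z, continuous H}.
  move=> zbd; apply: continuous_mulC; first by apply: Gc; apply: Fc; exact: square_bdry_sub.
  by apply: derivable_continuous; apply: derivable_inv_sub; exact: zb.
have Scb z : square_bdry b r z -> {for z, continuous (slope c G b)}.
  by move=> zbd; apply: Sc; exact: square_bdry_sub.
have E : im_contour_square (fun z => (z - b)^-1) b r = im_contour_square H b r.
  rewrite -[RHS]subr0 -S0 /im_contour_square -(im_contourB Hc Scb); apply: eq_im_contour => z /zb zn.
  by rewrite slope_neq// Gb /H; ring.
have := im_contour_inv b r0; rewrite E => H4.
have Fb : 0 < rnorm (F b) by rewrite rnorm_gt0.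
have HM z : square_bdry b r z -> rnorm (H z) <= M / (rnorm (F b) * r).
  move=> zbd; rewrite /H /G !rnormM !rnormV invfM mulrA.
  apply: ler_pM; rewrite ?mulr_ge0 ?invr_ge0 ?rnorm_ge0//.
    by rewrite mulrC ler_wpM2r ?invr_ge0 ?rnorm_ge0//; exact: FM.
  have := square_bdry_rnorm r0 zbd => rz; rewrite lef_pV2 ?posrE//; exact: lt_le_trans rz.
have x01 : complex.Re b - r <= complex.Re b + r by lra.
have y01 : complex.Im b - r <= complex.Im b + r by lra.
have := im_contour_bound x01 y01 Hc HM; rewrite -/(im_contour_square H b r) => H8.
have : 4 <= 2 * (M / (rnorm (F b) * r)) * (4 * r).
  apply: le_trans H4 _; apply: le_trans (ler_norm _) (le_trans H8 _).
  by rewrite le_eqVlt; apply/orP; left; apply/eqP; ring.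
have -> : 2 * (M / (rnorm (F b) * r)) * (4 * r) = 8 * M / rnorm (F b).
  by field; rewrite !gt_eqF.
by rewrite ler_pdivlMr//; lra.
Qed.

End Cauchy.

(** * The maximum modulus principle *)

Section MaxModulus.
Local Open Scope complex_scope.
Context {R : realType}.
Implicit Types (F G : C R -> C R) (x y : R).

(** Cauchy's estimate for the divided difference based at [a]. *)
Lemma lipschitz_center F (a b : C R) (r M : R) : 0 < r ->
  (forall z, rnorm (z - a) < 3 * r -> derivable F z 1) ->
  (forall z, rnorm (z - a) < 3 * r -> rnorm (F z) <= M) ->
  rnorm (b - a) <= r / 2 -> rnorm (F b - F a) <= 8 * M / r * rnorm (b - a).
Proof.
move=> r0 dF FM ba.
have [->|bna] := eqVneq b a; first by rewrite !subrr !rnorm0 mulr0.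
(* The square of half-side [r] centred at [b] stays within [3 * r] of [a],
   and its sides stay at distance [r / 2] from [a]. *)
have aa : rnorm (a - a) < 3 * r by rewrite subrr rnorm0; lra.
have [c cc] := slope_exists (dF a aa).
have sub z : square b r z -> rnorm (z - a) < 3 * r.
  by move=> /square_rnorm h; apply: le_lt_trans (rnorm_triangle z b a) _; lra.
have dS z : rnorm (z - a) < 3 * r -> z != a -> derivable (slope c F a) z 1.
  by move=> za zn; have := @derivable_slope R c F a z zn; apply; exact: dF.
have bd : rnorm (slope c F a b) <= 2 * (4 * M / r).
  apply: (@cauchy_center_bound _ _ [:: a] b r _ r0).
  - move=> z /sub za; have [->|zn] := eqVneq z a; first exact: cc.
    by apply: derivable_continuous; exact: dS.
  - by move=> z /sub za; rewrite inE => zn; exact: dS.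
  - apply: dS => //; apply: sub; split; apply/andP; split; lra.
  - move=> z zb; have rz := square_bdry_rnorm r0 zb; have za := sub _ (square_bdry_sub r0 zb).
    have h : r / 2 <= rnorm (z - a).
      by have := rnorm_triangle z a b; rewrite (rnorm_distC a b); lra.
    have zn : z != a by rewrite -subr_eq0 -rnorm_gt0; lra.
    rewrite slope_neq// rnormM rnormV ler_pdivrMr; last lra.
    have : rnorm (F z - F a) <= 2 * M.
      by apply: le_trans (rnormB_le _ _) _; have := FM _ za; have := FM _ aa; lra.
    move=> h2; apply: le_trans h2 _.
    have M0 : 0 <= M by apply: le_trans (FM _ aa); exact: rnorm_ge0.
    have -> : 2 * M = 4 * M / r * (r / 2) by field; rewrite gt_eqF.
    by rewrite ler_wpM2l// divr_ge0//; lra.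
move: bd; rewrite slope_neq// rnormM rnormV ler_pdivrMr ?rnorm_gt0 ?subr_eq0//.
by rewrite [2 * _]mulrA [2 * _]mulrA -natrM.
Qed.

(** [w ^ 2 - 1 = (w - 1) * (w + 1)] with [|w + 1| >= 3 / 2]: repeated squaring
would move a power of [v] away from 1 geometrically. *)
Lemma pow_near1 (v : C R) : (forall n, rnorm (v ^+ n - 1) <= 1 / 2) -> v = 1.
Proof.
move=> H; apply/eqP/contraT => v1.
have t0 : 0 < rnorm (v - 1) by rewrite rnorm_gt0 subr_eq0.
have grow k : (1 + k%:R / 2) * rnorm (v - 1) <= rnorm (v ^+ (2 ^ k) - 1).
  elim: k => [|k IH]; first by rewrite mul0r addr0 mul1r expn0 expr1.
  rewrite expnSr exprM; set w := v ^+ _ in IH *.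
  have -> : w ^+ 2 - 1 = (w - 1) * (w + 1) by ring.
  rewrite rnormM.
  have w3 : 3 / 2 <= rnorm (w + 1).
    have := rnorm_sub_ge (2 : C R) (- (w - 1)); rewrite rnormN opprK.
    have -> : (2 : C R) + (w - 1) = w + 1 by ring.
    have -> : rnorm (2 : C R) = 2.
      by have := rnorm_real (2 : R); rewrite rmorphMn rmorph1 normr_nat.
    by have := H (2 ^ k)%N; rewrite -/w; lra.
  have w0 : 0 <= rnorm (w - 1) := rnorm_ge0 _.
  rewrite -natr1; have k0 : (0 : R) <= k%:R by []; nra.
have t0' : 0 <= (rnorm (v - 1))^-1 by rewrite invr_ge0 ltW.
have := archi_boundP t0'.
set k := Num.bound _ => hk.
have : 1 < k%:R * rnorm (v - 1) by rewrite -ltr_pdivrMr// div1r.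
by have := grow k; have := H (2 ^ k)%N; nra.
Qed.

Lemma derivable_exp F (z : C R) n : derivable F z 1 -> derivable (fun z => F z ^+ n) z 1.
Proof.
move=> dF; elim: n => [|n IH]; first exact: derivable_cst.
rewrite (_ : (fun _ => _) = (fun z => F z * F z ^+ n)); last first.
  by apply/funext => w; rewrite exprS.
by apply: derivableM; [exact: dF|exact: IH].
Qed.

(** With the modulus of [F] maximal at [a], all the powers of [F / F a] are bounded
by 1, hence share the Lipschitz constant of [lipschitz_center]: on a small disc
they all stay close to 1, which leaves only the constant function. *)
Lemma local_constant F (a : C R) (r : R) : 0 < r ->
  (forall z, rnorm (z - a) < r -> derivable F z 1) ->
  (forall z, rnorm (z - a) < r -> rnorm (F z) <= rnorm (F a)) ->
  exists2 d : R, 0 < d & forall z, rnorm (z - a) < d -> F z = F a.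
Proof.
move=> r0 dF Fa.
have [F0|F0] := eqVneq (F a) 0.
  exists r => // z /Fa; rewrite F0 rnorm0 => h.
  by apply/eqP; rewrite -rnorm_eq0; apply/eqP/le_anti; rewrite h rnorm_ge0.
have nF0 : 0 < rnorm (F a) by rewrite rnorm_gt0.
(* With the Lipschitz constant [8 / (r / 3)], the powers move by at most 1 / 2
   within distance [r / 48]. *)
exists (r / 48); first lra.
move=> z za; suff : (F a)^-1 * F z = 1.
  by move=> h; rewrite -[F z](mulVKf F0) h mulr1.
apply: pow_near1 => n.
pose G w := ((F a)^-1 * F w) ^+ n.
have r3 : 0 < r / 3 by lra.
have Er : 3 * (r / 3) = r by lra.
have := @lipschitz_center G a z (r / 3) 1 r3; rewrite Er.
have -> : G a = 1 by rewrite /G mulVf// expr1n.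
have h1 w : rnorm (w - a) < r -> derivable G w 1.
  move=> /dF dw; apply: derivable_exp; apply: derivableM; [exact: derivable_cst|exact: dw].
have h2 w : rnorm (w - a) < r -> rnorm (G w) <= 1.
  move=> /Fa Fw; rewrite /G rnormX rnormM rnormV exprn_ile1 ?mulr_ge0 ?invr_ge0 ?rnorm_ge0//.
  by rewrite mulrC ler_pdivrMr// mul1r.
have h3 : rnorm (z - a) <= r / 3 / 2 by lra.
move=> /(_ h1 h2 h3) /le_trans; apply.
have -> : 8 * 1 / (r / 3) * rnorm (z - a) = 24 * rnorm (z - a) / r by field; rewrite gt_eqF.
rewrite ler_pdivrMr//; lra.
Qed.

Definition disc (a : C R) (r : R) : set (C R) := [set z | rnorm (z - a) <= r].

Lemma closed_disc (a : C R) (r : R) : closed (disc a r).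
Proof.
rewrite -openC; apply: open_rnormP => z /negP; rewrite -ltNge => rz.
exists (rnorm (z - a) - r); first by rewrite subr_gt0.
move=> w wz; apply/negP; rewrite -ltNge.
by have := rnorm_triangle z w a; rewrite (rnorm_distC z w); lra.
Qed.

Lemma continuous_cplx : continuous (fun p : R * R => cplx p.1 p.2 : C R).
Proof.
move=> [a b]; apply/cvg_rnormP => e e0; have e2 : 0 < e / 2 by lra.
exists (ball a (e / 2), ball b (e / 2)); first by split; exact: nbhsx_ballx.
move=> [x y] [/= h1 h2]; apply: le_lt_trans (rnorm_le_ReIm _) _; rewrite ReB ImB /=.
rewrite -ball_normE/= distrC in h1; rewrite -ball_normE/= distrC in h2; lra.
Qed.

Lemma compact_disc (a : C R) (r : R) : compact (disc a r).
Proof.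
pose K := (fun p : R * R => cplx p.1 p.2 : C R) @`
  (`[complex.Re a - r, complex.Re a + r] `*` `[complex.Im a - r, complex.Im a + r]).
apply: (@subclosed_compact _ _ K); first exact: closed_disc.
- apply: continuous_compact; first by apply: continuous_subspaceT; exact: continuous_cplx.
  by apply: compact_setX; exact: segment_compact.
- move=> z zr; exists (complex.Re z, complex.Im z); last by rewrite -cplxE.
  have := le_trans (rnorm_Re _) zr; have := le_trans (rnorm_Im _) zr.
  rewrite ReB ImB !ler_norml => /andP[h1 h2] /andP[h3 h4].
  by split => /=; rewrite in_itv/=; apply/andP; split; lra.
Qed.

Lemma continuous_rnorm F (z : C R) :
  {for z, continuous F} -> {for z, continuous (fun z => rnorm (F z))}.
Proof.
move=> /continuous_rnormP Fc; apply: continuous_real => e /Fc[d d0 dF].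
exists d => // w /dF; apply: le_lt_trans.
by rewrite ler_norml; have := rnorm_sub_ge (F w) (F z); have := rnorm_sub_ge (F z) (F w);
  rewrite (rnorm_distC (F z)) => *; apply/andP; split; lra.
Qed.

Lemma continuous_Re (z : C R) : {for z, continuous (@complex.Re R : C R -> R)}.
Proof.
apply: continuous_real => e e0; exists e => // w; apply: le_lt_trans.
by rewrite rnorm_distC -ReB; exact: rnorm_Re.
Qed.

(** A point of maximal modulus above [M] is interior and not a zero, so that [F] is
differentiable near it, and the same holds at each point with the same value;
among these, one with largest real part contradicts [local_constant]. *)
Lemma max_modulus F (a : C R) (r M : R) : 0 < r ->
  (forall z, rnorm (z - a) <= r -> {for z, continuous F}) ->
  (forall z, rnorm (z - a) < r -> F z != 0 -> derivable F z 1) ->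
  (forall z, rnorm (z - a) = r -> rnorm (F z) <= M) ->
  forall z, rnorm (z - a) <= r -> rnorm (F z) <= M.
Proof.
move=> r0 Fc dF FM z1 z1a; rewrite leNgt; apply/negP => Mz1.
have M0 : 0 <= M.
  apply: le_trans (FM (a + r%:C) _); first exact: rnorm_ge0.
  by rewrite addrAC subrr add0r rnorm_real gtr0_norm.
have cD : compact (disc a r) by exact: compact_disc.
have [||p pD pmax] := @compact_EVT_max _ R (fun z => rnorm (F z)) _ _ cD.
- by exists z1.
- by apply: continuous_in_subspaceT => z /set_mem zD; apply: continuous_rnorm; exact: Fc.
move: pD => /set_mem pD.
have {}pmax z : rnorm (z - a) <= r -> rnorm (F z) <= rnorm (F p).
  by move=> zD; apply: pmax; exact/mem_set.
have Mp : M < rnorm (F p) by apply: lt_le_trans Mz1 _; exact: pmax.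
pose K := disc a r `&` [set z | F z = F p].
have cK : compact K.
  apply: (@subclosed_compact _ _ (disc a r)) => //; last by move=> z [].
  rewrite -openC; apply: open_rnormP => z zK.
  have [zD|zD] := pselect (disc a r z); last first.
    have : open (~` disc a r) by rewrite openC; exact: closed_disc.
    rewrite openE => /(_ z zD) /nbhs_rnormP[d d0 dz]; exists d => // y /dz yD [].
    by move=> /yD.
  have Fzp : F z != F p by apply/eqP => h; apply: zK; split.
  have e0 : 0 < rnorm (F z - F p) by rewrite rnorm_gt0 subr_eq0.
  have /continuous_rnormP /(_ _ e0)[d d0 dF'] := Fc z zD.
  exists d => // y /dF' yd [_ /= yp]; move: yd.
  by rewrite yp rnorm_distC ltxx.
have [||q /set_mem[qD qp] qmax] :=
  @compact_EVT_max (C R) R (fun z : C R => complex.Re z) _ _ cK.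
- by exists p; split.
- by apply: continuous_in_subspaceT => z _; exact: continuous_Re.
have qr : rnorm (q - a) < r.
  rewrite lt_neqAle; apply/andP; split; last exact: qD.
  by apply/eqP => /FM; rewrite qp leNgt Mp.
have Fq0 : F q != 0 by rewrite qp -rnorm_gt0; lra.
have nq0 : 0 < rnorm (F q) by rewrite rnorm_gt0.
have /continuous_rnormP /(_ _ nq0)[d1 d10 d1F] := Fc q qD.
pose d2 := Num.min d1 (r - rnorm (q - a)).
have d20 : 0 < d2 by rewrite lt_min d10 subr_gt0.
have inD z : rnorm (z - q) < d2 -> rnorm (z - a) < r.
  rewrite lt_min => /andP[_ h]; apply: le_lt_trans (rnorm_triangle z q a) _; lra.
have [|| d3 d30 d3F] := @local_constant F q d2 d20.
- move=> z zq; apply: dF; first exact: inD.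
  move: zq; rewrite lt_min => /andP[/d1F h _]; apply: contraTneq h => ->.
  by rewrite sub0r rnormN ltxx.
- by move=> z /inD /ltW /pmax; rewrite qp.
pose d := Num.min d2 d3 / 2.
have d0 : 0 < d by rewrite divr_gt0// lt_min d20.
have [dd2 dd3] : d < d2 /\ d < d3.
  have : Num.min d2 d3 <= d2 by rewrite ge_min lexx.
  have : Num.min d2 d3 <= d3 by rewrite ge_min lexx orbT.
  by rewrite /d; split; lra.
have nd : rnorm (q + d%:C - q) = d by rewrite addrAC subrr add0r rnorm_real gtr0_norm.
have : q + d%:C \in K.
  apply/mem_set; split; first by apply: ltW; apply: inD; rewrite nd.
  by rewrite /= d3F ?nd.
by move=> /qmax; rewrite ReD /= gerDl leNgt d0.
Qed.

End MaxModulus.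

(** * Functions holomorphic off a zero set *)

Section Rado.
Local Open Scope complex_scope.
Context {R : realType}.
Implicit Types (F G h : C R -> C R).

Lemma exp_unbounded (q B : R) : 1 < q -> exists n, B < q ^+ n.
Proof.
move=> q1.
have bern n : 1 + n%:R * (q - 1) <= q ^+ n.
  elim: n => [|n IH]; first by rewrite mul0r addr0 expr0.
  have : 0 <= n%:R * (q - 1) * (q - 1) by rewrite !mulr_ge0// subr_ge0 ltW.
  rewrite exprS -natr1; have := ler_wpM2l (ltW (lt_trans ltr01 q1)) IH; lra.
have [B0|B0] := leP B 0; first by exists 0%N; rewrite expr0; lra.
have q0 : 0 < q - 1 by lra.
have := archi_boundP (ltW (divr_gt0 B0 q0)); set n := Num.bound _ => hn.
exists n; move: hn; rewrite ltr_pdivrMr// => hn.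
by apply: lt_le_trans (bern n); lra.
Qed.

Variables (a : C R) (r : R).
Hypothesis r0 : 0 < r.

(** The functions continuous on the closed disc and holomorphic on the open disc
outside the zeros of [h]. *)
Definition holomorphic_off h F := (forall z, rnorm (z - a) <= r -> {for z, continuous F}) /\
  (forall z, rnorm (z - a) < r -> h z != 0 -> derivable F z 1).

Lemma holomorphic_off_mul h F G :
  holomorphic_off h F -> holomorphic_off h G -> holomorphic_off h (fun z => F z * G z).
Proof.
move=> [Fc dF] [Gc dG]; split=> z za.
  by apply: continuous_mulC; [exact: Fc|exact: Gc].
by move=> hz; apply: derivableM; [exact: dF|exact: dG].
Qed.

Lemma holomorphic_off_exp h F n : holomorphic_off h F -> holomorphic_off h (fun z => F z ^+ n).
Proof.
move=> FH; elim: n => [|n IH].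
  by split=> z *; [exact: cst_continuous|exact: derivable_cst].
rewrite (_ : (fun _ => _) = (fun z => F z * F z ^+ n)); last first.
  by apply/funext => w; rewrite exprS.
exact: holomorphic_off_mul.
Qed.

(** The base point of a divided difference is a new exceptional point; it is
added to the zeros of [h]. *)
Lemma holomorphic_off_slope h F (c k : C R) : holomorphic_off h h -> holomorphic_off h F ->
  {for c, continuous (slope k F c)} ->
  holomorphic_off (fun z => h z * (z - c)) (fun z => h z * (z - c)) /\
  holomorphic_off (fun z => h z * (z - c)) (slope k F c).
Proof.
move=> [hc dh] [Fc dF] kc.
have dB z : derivable (fun z : C R => z - c) z 1.
  by apply: derivableB; [exact: derivable_id|exact: derivable_cst].
split; split=> z za.
- apply: continuous_mulC; first exact: hc.
  by apply: derivable_continuous; exact: dB.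
- rewrite mulf_eq0 negb_or => /andP[hz _]; apply: derivableM; [exact: dh|exact: dB].
- have [->|zc] := eqVneq z c; first exact: kc.
  by have := @continuous_slope R k F c z zc; apply; exact: Fc.
- rewrite mulf_eq0 negb_or subr_eq0 => /andP[hz zc].
  by have := @derivable_slope R k F c z zc; apply; exact: dF.
Qed.

(** The products [F ^ n * h] vanish at the exceptional points, so the maximum
principle applies to them and gives [|F z| ^ n * |h z| <= M ^ n * sup |h|]; then
let [n] grow. *)
Lemma rado_max_modulus h F (M : R) : holomorphic_off h h -> holomorphic_off h F ->
  (forall z, rnorm (z - a) = r -> rnorm (F z) <= M) ->
  forall z, rnorm (z - a) <= r -> h z != 0 -> rnorm (F z) <= M.
Proof.
move=> hh FF FM z za hz; rewrite leNgt; apply/negP => MF.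
have M0 : 0 <= M.
  apply: le_trans (FM (a + r%:C) _); first exact: rnorm_ge0.
  by rewrite addrAC subrr add0r rnorm_real gtr0_norm.
have [||p _ pmax] := @compact_EVT_max (C R) R (fun z => rnorm (h z)) _ _ (@compact_disc R a r).
- by exists z.
- by apply: continuous_in_subspaceT => w /set_mem wD; apply: continuous_rnorm; apply: hh.1.
have {}pmax w : rnorm (w - a) <= r -> rnorm (h w) <= rnorm (h p).
  by move=> wD; apply: pmax; exact/mem_set.
(* [m] replaces [M] to avoid dividing by zero. *)
pose m := (M + rnorm (F z)) / 2.
have [Mm mF] : M <= m /\ m < rnorm (F z) by rewrite /m; split; lra.
have m0 : 0 < m by rewrite /m; lra.
have hz0 : 0 < rnorm (h z) by rewrite rnorm_gt0.
have q1 : 1 < rnorm (F z) / m by rewrite ltr_pdivlMr ?mul1r.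
have [n] := exp_unbounded (rnorm (h p) / rnorm (h z)) q1.
rewrite ltr_pdivrMr// expr_div_n mulrAC ltr_pdivlMr ?exprn_gt0//.
apply/negP; rewrite -leNgt -rnormX -rnormM.
have [Gc dG] := holomorphic_off_mul (holomorphic_off_exp n FF) hh.
have dG' w : rnorm (w - a) < r -> F w ^+ n * h w != 0 ->
    derivable (fun z => F z ^+ n * h z) w 1.
  by rewrite mulf_eq0 negb_or => wa /andP[_ hw]; exact: dG.
apply: (max_modulus r0 Gc dG') => // w wa.
rewrite rnormM rnormX mulrC; apply: ler_pM; rewrite ?exprn_ge0 ?rnorm_ge0//.
  by apply: pmax; rewrite wa.
by apply: lerXn2r; rewrite ?nnegrE ?rnorm_ge0 ?(ltW m0)// (le_trans (FM _ wa)).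
Qed.

(** The maximum principle for the divided difference based at [c], which is at
most [2 * M / (r / 2)] on the circle. *)
Lemma rado_lipschitz h F (M : R) (c y : C R) : holomorphic_off h h -> holomorphic_off h F ->
  (forall z, rnorm (z - a) = r -> rnorm (F z) <= M) ->
  rnorm (c - a) <= r / 2 -> rnorm (y - a) <= r -> h c != 0 -> h y != 0 ->
  rnorm (F y - F c) <= 4 * M / r * rnorm (y - c).
Proof.
move=> hh FF FM ca ya hc hy.
have [->|yc] := eqVneq y c; first by rewrite !subrr !rnorm0 mulr0.
have r2 : r / 2 < r by have := r0; lra.
have car : rnorm (c - a) < r := le_lt_trans ca r2.
have [k kc] := slope_exists (FF.2 c car hc).
have [hh' FF'] := holomorphic_off_slope hh FF kc.
have Fc : rnorm (F c) <= M by apply: (rado_max_modulus hh FF FM) => //; exact: ltW.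
have nyc : 0 < rnorm (y - c) by rewrite rnorm_gt0 subr_eq0.
suff : rnorm (slope k F c y) <= 4 * M / r.
  by rewrite slope_neq// rnormM rnormV ler_pdivrMr.
apply: (rado_max_modulus hh' FF') => //; last by rewrite mulf_neq0// subr_eq0.
move=> z za; have zc2 : r / 2 <= rnorm (z - c).
  by have := rnorm_triangle z c a; lra.
have zc : z != c by rewrite -subr_eq0 -rnorm_gt0; lra.
rewrite slope_neq// rnormM rnormV ler_pdivrMr; last lra.
apply: (@le_trans _ _ (2 * M)).
  by apply: le_trans (rnormB_le _ _) _; have := FM z za; lra.
have M0 : 0 <= M by apply: le_trans Fc; exact: rnorm_ge0.
have -> : 2 * M = 4 * M / r * (r / 2) by field; rewrite gt_eqF.
by rewrite ler_wpM2l// divr_ge0//; lra.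
Qed.

(** [rado_lipschitz] for the divided difference based at [p]. *)
Lemma rado_second_difference h F (M : R) (p b c : C R) :
  holomorphic_off h h -> holomorphic_off h F ->
  (forall z, rnorm (z - a) = r -> rnorm (F z) <= M) ->
  rnorm (p - a) <= r / 2 -> rnorm (b - a) <= r -> rnorm (c - a) <= r / 2 ->
  h p != 0 -> h b != 0 -> h c != 0 -> b != p -> c != p ->
  rnorm ((F b - F p) / (b - p) - (F c - F p) / (c - p)) <= 16 * M / r ^+ 2 * rnorm (b - c).
Proof.
move=> hh FF FM pa ba ca hp hb hc bp cp.
have r2 : r / 2 < r by have := r0; lra.
have par : rnorm (p - a) < r := le_lt_trans pa r2.
have [k kc] := slope_exists (FF.2 p par hp).
have [hh' FF'] := holomorphic_off_slope hh FF kc.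
rewrite -!(slope_neq k)//.
have -> : 16 * M / r ^+ 2 = 4 * (4 * M / r) / r by field; rewrite gt_eqF.
apply: (rado_lipschitz hh' FF') => //; try by rewrite mulf_neq0// subr_eq0.
have Fp : rnorm (F p) <= M by apply: (rado_max_modulus hh FF FM) => //; exact: ltW.
move=> z za; have zc2 : r / 2 <= rnorm (z - p).
  by have := rnorm_triangle z p a; lra.
have zc : z != p by rewrite -subr_eq0 -rnorm_gt0; lra.
rewrite slope_neq// rnormM rnormV ler_pdivrMr; last lra.
apply: (@le_trans _ _ (2 * M)).
  by apply: le_trans (rnormB_le _ _) _; have := FM z za; lra.
have M0 : 0 <= M by apply: le_trans Fp; exact: rnorm_ge0.
have -> : 2 * M = 4 * M / r * (r / 2) by field; rewrite gt_eqF.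
by rewrite ler_wpM2l// divr_ge0//; lra.
Qed.

End Rado.

(** * Completeness of the complex numbers *)

Section Complete.
Context {R : realType}.

Lemma cauchy_real (T : Type) (F : set_system T) (FF : ProperFilter F) (g : T -> R) :
  (forall e : R, 0 < e -> exists2 A, F A & forall x y, A x -> A y -> `|g x - g y| <= e) ->
  exists c : R, forall e, 0 < e -> \forall x \near F, `|g x - c| < e.
Proof.
move=> H; have : cvg (g @ F).
  apply/cauchy_cvgP/cauchy_exP => e e0.
  have e2 : 0 < e / 2 by lra.
  have [A FA Ag] := H _ e2; have [x Ax] := filter_ex FA.
  exists (g x); apply: (@filterS _ F _ A) => // y Ay.
  by rewrite /ball/= (le_lt_trans (Ag x y Ax Ay))//; lra.
move=> cg; exists (lim (g @ F)) => e e0.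
have /cvgrPdist_lt/(_ _ e0) := cg.
by apply: filterS => x; rewrite distrC.
Qed.

(** Convergence of real and imaginary parts. *)
Lemma cauchy_complex (T : Type) (F : set_system T) (FF : ProperFilter F) (g : T -> C R) :
  (forall e : R, 0 < e -> exists2 A, F A & forall x y, A x -> A y -> rnorm (g x - g y) <= e) ->
  exists c : C R, g @ F --> c.
Proof.
move=> H.
have [|a aP] := @cauchy_real _ _ FF (fun x => complex.Re (g x)).
  move=> e /H[A FA Ag]; exists A => // x y Ax Ay.
  by rewrite -ReB; apply: le_trans (rnorm_Re _) _; exact: Ag.
have [|b bP] := @cauchy_real _ _ FF (fun x => complex.Im (g x)).
  move=> e /H[A FA Ag]; exists A => // x y Ax Ay.
  by rewrite -ImB; apply: le_trans (rnorm_Im _) _; exact: Ag.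
exists (cplx a b); apply/cvg_rnormP => e e0; have e2 : 0 < e / 2 by lra.
apply: filterS2 (aP _ e2) (bP _ e2) => x h1 h2.
by apply: le_lt_trans (rnorm_le_ReIm _) _; rewrite ReB ImB /=; lra.
Qed.

End Complete.

(** * A removable singularity theorem in several variables *)

Section RadoSeveral.
Local Open Scope complex_scope.
Context {R : realType} {W : normedModType (C R)}.
Variables (V : set W) (f h : W -> C R).
Hypothesis fc : forall w, V w -> {for w, continuous f}.
Hypothesis hc : forall w, V w -> {for w, continuous h}.
Hypothesis df : forall w, V w -> h w != 0 -> differentiable f w.
Hypothesis dh : forall w, V w -> h w != 0 -> differentiable h w.

Lemma differentiable_line (w v : W) (t : C R) : differentiable (fun t : C R => w + t *: v) t.
Proof.
apply: differentiableD; first exact: differentiable_cst.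
by apply: ex_diff.
Qed.

Lemma linear_mul (D : {linear W -> C R}) (t : C R) (v : W) : D (t *: v) = t * D v.
Proof. by rewrite linearZ. Qed.

Lemma holomorphic_off_on_line (w v : W) : (forall t : C R, rnorm t <= 2 -> V (w + t *: v)) ->
  holomorphic_off 0 2 (fun t => h (w + t *: v)) (fun t => f (w + t *: v)) /\
  holomorphic_off 0 2 (fun t => h (w + t *: v)) (fun t => h (w + t *: v)).
Proof.
move=> lV.
have lc (g : W -> C R) t : {for w + t *: v, continuous g} ->
    {for t, continuous (fun t : C R => g (w + t *: v))}.
  move=> /continuous_rnormP gc; apply/continuous_rnormP => e /gc[d d0 dg].
  have v1 : 0 < rnorm v + 1 by have := rnorm_ge0 v; lra.
  exists (d / (rnorm v + 1)); first exact: divr_gt0.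
  move=> s; rewrite ltr_pdivlMr// => sd; apply: dg.
  rewrite opprD addrACA subrr add0r -scalerBl rnormZ; apply: le_lt_trans sd.
  by rewrite ler_wpM2l ?rnorm_ge0// lerDl.
have ld (g : W -> C R) t : differentiable g (w + t *: v) ->
    derivable (fun t : C R => g (w + t *: v)) t 1.
  move=> gd; apply/derivable1_diffP;
  exact: (@differentiable_comp _ _ _ _ (fun t : C R => w + t *: v) g t
    (differentiable_line w v t) gd).
split; split=> t; rewrite subr0 => t2.
- by apply: lc; apply: fc; exact: lV.
- by move=> ht; apply: ld; apply: df ht; apply: lV; exact: ltW.
- by apply: lc; apply: hc; exact: lV.
- by move=> ht; apply: ld; apply: dh ht; apply: lV; exact: ltW.
Qed.

Variables (w0 : W) (r M : R).
Hypothesis r0 : 0 < r.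
Hypothesis ball_bound : forall w, rnorm (w - w0) < 4 * r -> V w /\ rnorm (f w) <= M.

Lemma bound_ge0 : 0 <= M.
Proof.
have [|_ h0] := ball_bound (w := w0); first by rewrite subrr rnorm0 mulr_gt0.
exact: le_trans (rnorm_ge0 _) h0.
Qed.

(** Along every complex line through [w] in the ball, [f] satisfies the
hypotheses of [rado_second_difference] on the disc of radius 2. *)
Lemma second_difference_line (w v : W) (t s : C R) :
  rnorm (w - w0) < r -> rnorm v < r -> h w != 0 -> rnorm t <= 1 -> rnorm s <= 1 ->
  t != 0 -> s != 0 ->
  h (w + t *: v) != 0 -> h (w + s *: v) != 0 ->
  rnorm ((f (w + t *: v) - f w) / t - (f (w + s *: v) - f w) / s) <= 4 * M * rnorm (t - s).
Proof.
move=> ww0 vr hw t1 s1 t0 s0 ht hs.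
have lV (u : C R) : rnorm u <= 2 -> rnorm (w + u *: v - w0) < 4 * r.
  move=> u2; rewrite addrAC; apply: le_lt_trans (rnormD _ _) _; rewrite rnormZ.
  have : rnorm u * rnorm v <= 2 * r by apply: ler_pM; rewrite ?rnorm_ge0// ltW.
  by move=> ?; have := r0; lra.
have [] := holomorphic_off_on_line (w := w) (v := v); first by move=> u /lV /ball_bound[].
move=> FF HH; have two0 : (0 : R) < 2 by [].
have := @rado_second_difference R 0 2 two0 _ _ M 0 t s HH FF.
rewrite !subr0 scale0r addr0 rnorm0.
have -> : 16 * M / 2 ^+ 2 = 4 * M :> R by field.
have -> : 2 / 2 = 1 :> R by field.
apply => //.
- by move=> z; rewrite subr0 => z2; apply: (ball_bound _).2; apply: lV; rewrite z2.
- lra.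
Qed.

Lemma near_nonzero (x : W) : V x -> h x != 0 -> \forall y \near x, h y != 0.
Proof.
move=> Vx hx; have n0 : 0 < rnorm (h x) by rewrite rnorm_gt0.
have /continuous_rnormP/(_ _ n0)[d d0 dH] := hc Vx.
apply/nbhs_rnormP; exists d => // y /dH; apply: contraTneq => ->.
by rewrite sub0r rnormN ltxx.
Qed.

(** Let [s] go to 0 in [second_difference_line]: the second quotient tends to the
differential. *)
Lemma taylor_nonzero_scaled (w v : W) (t : C R) :
  rnorm (w - w0) < r -> rnorm v < r -> h w != 0 -> rnorm t <= 1 -> t != 0 ->
  h (w + t *: v) != 0 ->
  rnorm ((f (w + t *: v) - f w) / t - 'd f w v) <= 4 * M * rnorm t.
Proof.
move=> ww0 vr hw t1 t0 ht; have M0 := bound_ge0.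
have w4 : rnorm (w - w0) < 4 * r by have := r0; lra.
have [Vw _] := ball_bound w4.
apply/ler_addgt0Pr => e e0.
have v1 : 0 < rnorm v + 1 by have := rnorm_ge0 v; lra.
have e2 : 0 < e / (2 * (rnorm v + 1)) by rewrite divr_gt0// mulr_gt0.
have [d d0 dD] := differentiable_bound (df Vw hw) e2.
have /nbhs_rnormP[d2 d20 d2h] := near_nonzero Vw hw.
pose m := Num.min (Num.min 1 (e / (8 * (M + 1)))) (Num.min d d2 / (rnorm v + 1)).
have m0 : 0 < m by rewrite !lt_min ltr01 !divr_gt0// ?lt_min ?d0// mulr_gt0//; lra.
pose s : C R := (m / 2)%:C.
have ns : rnorm s = m / 2 by rewrite rnorm_real gtr0_norm// divr_gt0.
have ns0 : 0 < rnorm s by rewrite ns divr_gt0.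
have sm : rnorm s < m by rewrite ns; lra.
have s0 : s != 0 by rewrite -rnorm_gt0.
have [s1 [se sv]] : rnorm s <= 1 /\
    rnorm s < e / (8 * (M + 1)) /\ rnorm s < Num.min d d2 / (rnorm v + 1).
  by move: sm; rewrite !lt_min => /andP[/andP[? ?] ?]; split; [exact: ltW|split].
have {}sv : rnorm (s *: v) < Num.min d d2.
  rewrite rnormZ; rewrite ltr_pdivlMr// in sv; apply: le_lt_trans sv.
  by rewrite ler_wpM2l ?rnorm_ge0// lerDl.
have [svd svd2] : rnorm (s *: v) < d /\ rnorm (s *: v) < d2.
  by move: sv; rewrite lt_min => /andP[].
have hs : h (w + s *: v) != 0 by apply: d2h; rewrite addrAC subrr add0r.
have H1 := second_difference_line ww0 vr hw t1 s1 t0 s0 ht hs.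
have H2 : rnorm ((f (w + s *: v) - f w) / s - 'd f w v) <= e / 2.
  have -> : (f (w + s *: v) - f w) / s - 'd f w v =
      (f (w + s *: v) - f w - 'd f w (s *: v)) / s.
    by rewrite linear_mul [RHS]mulrBl (mulrC s) mulfK.
  rewrite rnormM rnormV ler_pdivrMr//; apply: le_trans (dD _ svd) _; rewrite rnormZ.
  rewrite (mulrC (rnorm s)) mulrA ler_pM2r//.
  have -> : e / 2 = e / (2 * (rnorm v + 1)) * (rnorm v + 1) by field; rewrite gt_eqF.
  by rewrite ler_wpM2l ?(ltW e2)// lerDl.
have H3 : rnorm (t - s) <= rnorm t + rnorm s by exact: rnormB_le.
have H4 : 4 * M * rnorm (t - s) <= 4 * M * rnorm t + e / 2.
  have : rnorm s * (8 * (M + 1)) <= e.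
    by rewrite -ler_pdivlMr ?(ltW se)// mulr_gt0// ltr_wpDl.
  have : 4 * M * rnorm (t - s) <= 4 * M * (rnorm t + rnorm s) by rewrite ler_wpM2l// mulr_ge0.
  have : 0 <= M * rnorm s by rewrite mulr_ge0// rnorm_ge0.
  by move: (rnorm_ge0 s); lra.
apply: le_trans (rnorm_triangle _ ((f (w + s *: v) - f w) / s) _) _.
by lra.
Qed.

(** A second derivative bound of Cauchy type for [|f| <= M] on a ball of radius
comparable to [r]. *)
Definition taylor_const : R := 16 * M / r ^+ 2.

(** Rescale [v] to the length [r / 2], trading it for the parameter [t]. *)
Lemma taylor_nonzero (w v : W) :
  rnorm (w - w0) < r -> rnorm v < r / 2 -> h w != 0 -> h (w + v) != 0 ->
  rnorm (f (w + v) - f w - 'd f w v) <= taylor_const * rnorm v ^+ 2.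
Proof.
move=> ww0 vr hw hv; have M0 := bound_ge0.
have [->|v0] := eqVneq v 0.
  by rewrite addr0 subrr linear0 subr0 !rnorm0 expr0n /= mulr0.
have nv0 : 0 < rnorm v by rewrite rnorm_gt0.
pose t : C R := (2 * rnorm v / r)%:C.
have nt : rnorm t = 2 * rnorm v / r.
  by rewrite rnorm_real gtr0_norm// divr_gt0// mulr_gt0.
have nt0 : 0 < rnorm t by rewrite nt divr_gt0// mulr_gt0.
have t0 : t != 0 by rewrite -rnorm_gt0.
have t1 : rnorm t <= 1 by rewrite nt ler_pdivrMr// mul1r; lra.
pose v' := t^-1 *: v.
have tv : t *: v' = v by rewrite scalerA divff// scale1r.
have v'r : rnorm v' < r.
  rewrite rnormZ rnormV nt invf_div.
  rewrite (_ : r / (2 * rnorm v) * rnorm v = r / 2); last by field; rewrite gt_eqF.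
  by have := r0; lra.
have := @taylor_nonzero_scaled w v' t ww0 v'r hw t1 t0; rewrite tv => /(_ hv).
have -> : (f (w + v) - f w) / t - 'd f w v' = (f (w + v) - f w - 'd f w v) / t.
  have -> : 'd f w v = t * 'd f w v' by rewrite -linear_mul tv.
  by rewrite [RHS]mulrBl (mulrC t) mulfK.
rewrite rnormM rnormV ler_pdivrMr// => /le_trans; apply.
rewrite nt /taylor_const le_eqVlt; apply/orP; left; apply/eqP; field.
by rewrite gt_eqF.
Qed.

Hypothesis dense : forall w, V w -> forall d : R, 0 < d ->
  exists2 w', rnorm (w' - w) < d & h w' != 0.

Lemma taylor_const_ge0 : 0 <= taylor_const.
Proof. by rewrite divr_ge0 ?mulr_ge0 ?bound_ge0 ?exprn_ge0 ?(ltW r0). Qed.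

(** The restriction on the end point [w + v] disappears by density, both sides
being continuous in it. *)
Lemma taylor_bound (w v : W) :
  rnorm (w - w0) < r -> rnorm v < r / 2 -> h w != 0 ->
  rnorm (f (w + v) - f w - 'd f w v) <= taylor_const * rnorm v ^+ 2.
Proof.
move=> ww0 vr hw; have K0 := taylor_const_ge0; set K := taylor_const in K0 *.
have w4 : rnorm (w - w0) < 4 * r by have := r0; lra.
have [Vw _] := ball_bound w4.
have [k k0 kD] := continuous_linear_rnorm (diff_continuous (df Vw hw)).
(* [y] is a point near [w + v] where [h] does not vanish, close enough for the
   errors below to add up to [e]. *)
have x4 : rnorm (w + v - w0) < 4 * r.
  by rewrite addrAC; apply: le_lt_trans (rnormD _ _) _; have := r0; lra.
have [Vx _] := ball_bound x4.
apply/ler_addgt0Pr => e e0; have e2 : 0 < e / 2 by lra.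
have /continuous_rnormP/(_ _ e2)[d d0 dF] := fc Vx.
have c0 : 0 < K * (r + 1) + k by rewrite ltr_wpDl// mulr_ge0//; have := r0; lra.
pose m := Num.min (Num.min d 1) (Num.min (r / 2 - rnorm v) (e / (2 * (K * (r + 1) + k)))).
have m0 : 0 < m by rewrite !lt_min d0 ltr01 subr_gt0 vr divr_gt0// mulr_gt0.
have [y] := dense Vx m0.
set p := rnorm (y - _); rewrite !lt_min => /andP[/andP[yd y1] /andP[yr ye]] hy.
have p0 : 0 <= p by exact: rnorm_ge0.
have E : y = w + (y - w) by rewrite subrKC.
have yw : rnorm (y - w) <= rnorm v + p.
  have -> : y - w = v + (y - (w + v)) by rewrite [RHS]addrC opprD addrA subrK.
  exact: rnormD.
have ywr : rnorm (y - w) < r / 2 by lra.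
have hy' : h (w + (y - w)) != 0 by rewrite -E.
have := taylor_nonzero ww0 ywr hw hy'; rewrite -E -/K => H1.
have H2 : rnorm (f (w + v) - f y) < e / 2 by rewrite rnorm_distC; exact: dF.
have H3 : rnorm ('d f w (y - w) - 'd f w v) <= k * p.
  rewrite -linearB; apply: le_trans (kD _) _.
  by rewrite ler_wpM2l ?(ltW k0)// -addrA -opprD.
have H4 : rnorm (y - w) ^+ 2 <= rnorm v ^+ 2 + p * (r + 1).
  have := rnorm_ge0 v; have := rnorm_ge0 (y - w).
  by move: yw p0 y1 vr; nra.
have H5 : K * rnorm (y - w) ^+ 2 <= K * rnorm v ^+ 2 + K * (r + 1) * p.
  by have := ler_wpM2l K0 H4; lra.
have H6 : (K * (r + 1) + k) * p <= e / 2.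
  by move: ye; rewrite ltr_pdivlMr ?mulr_gt0//; lra.
have -> : f (w + v) - f w - 'd f w v = (f (w + v) - f y) + ((f y - f w - 'd f w (y - w)) +
  ('d f w (y - w) - 'd f w v)) by ring.
have := rnormD (f (w + v) - f y) ((f y - f w - 'd f w (y - w)) + ('d f w (y - w) - 'd f w v)).
have := rnormD (f y - f w - 'd f w (y - w)) ('d f w (y - w) - 'd f w v).
by clear - fc hc df dh dense r0 ball_bound H1 H2 H3 H5 H6; lra.
Qed.

(** The differential at [w] is uniformly approximated by difference quotients of
fixed step, which depend continuously on [w]. *)
Lemma derivative_cauchy (v : W) (e : R) : 0 < e -> exists2 d : R, 0 < d &
  forall w w', rnorm (w - w0) < d -> rnorm (w' - w0) < d -> h w != 0 -> h w' != 0 ->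
  rnorm ('d f w v - 'd f w' v) <= e.
Proof.
move=> e0; have K0 := taylor_const_ge0; set K := taylor_const in K0 *.
have v0 := rnorm_ge0 v; have rr := r0.
have c1 : 0 < 2 * (rnorm v + 1) by lra.
have c2 : 0 < 4 * (K * rnorm v ^+ 2 + 1) by rewrite mulr_gt0// ltr_wpDl// mulr_ge0// exprn_ge0.
pose m := Num.min (r / (2 * (rnorm v + 1))) (e / (4 * (K * rnorm v ^+ 2 + 1))).
have m0 : 0 < m by rewrite lt_min !divr_gt0.
pose t : C R := (m / 2)%:C.
have nt : rnorm t = m / 2 by rewrite rnorm_real gtr0_norm// divr_gt0.
have nt0 : 0 < rnorm t by rewrite nt divr_gt0.
have tm : rnorm t < m by rewrite nt; lra.
move: tm; rewrite lt_min ltr_pdivlMr// ltr_pdivlMr// => /andP[t1 t2].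
have tvr : rnorm (t *: v) < r / 2 by rewrite rnormZ; nra.
have w04 : rnorm (w0 - w0) < 4 * r by rewrite subrr rnorm0; lra.
have [Vw0 _] := ball_bound w04.
have [Vt _] : V (w0 + t *: v) /\ rnorm (f (w0 + t *: v)) <= M.
  by apply: ball_bound; rewrite addrAC subrr add0r; lra.
have te : 0 < rnorm t * e / 8 by rewrite divr_gt0// mulr_gt0.
have /continuous_rnormP/(_ _ te)[d1 d10 d1F] := fc Vw0.
have /continuous_rnormP/(_ _ te)[d2 d20 d2F] := fc Vt.
exists (Num.min r (Num.min d1 d2)); first by rewrite !lt_min r0 d10.
move=> w w'; rewrite !lt_min => /andP[wr /andP[wd1 wd2]] /andP[wr' /andP[wd1' wd2']] hw hw'.
have H1 := taylor_bound wr tvr hw; have H2 := taylor_bound wr' tvr hw'.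
have A1 := d1F _ wd1; have A2 := d1F _ wd1'.
have A3 : rnorm (f (w + t *: v) - f (w0 + t *: v)) < rnorm t * e / 8.
  by apply: d2F; rewrite opprD addrACA subrr addr0.
have A4 : rnorm (f (w' + t *: v) - f (w0 + t *: v)) < rnorm t * e / 8.
  by apply: d2F; rewrite opprD addrACA subrr addr0.
rewrite -(ler_pM2l nt0) -rnormM mulrBr -!linear_mul.
move: H1 H2; rewrite -/K.
set D := 'd f w _; set D' := 'd f w' _; set a := f (w + _); set a' := f (w' + _).
rewrite rnormZ => H1 H2.
have -> : D - D' = (a' - f w' - D') - (a - f w - D) +
    ((a - f (w0 + t *: v)) - (a' - f (w0 + t *: v)) -
     ((f w - f w0) - (f w' - f w0))) by ring.
have B1 := rnormD ((a' - f w' - D') - (a - f w - D))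
  ((a - f (w0 + t *: v)) - (a' - f (w0 + t *: v)) - ((f w - f w0) - (f w' - f w0))).
have B2 := rnormB_le (a' - f w' - D') (a - f w - D).
have B3 := rnormB_le ((a - f (w0 + t *: v)) - (a' - f (w0 + t *: v)))
  ((f w - f w0) - (f w' - f w0)).
have B4 := rnormB_le (a - f (w0 + t *: v)) (a' - f (w0 + t *: v)).
have B5 := rnormB_le (f w - f w0) (f w' - f w0).
have Kt : K * (rnorm t * rnorm v) ^+ 2 <= rnorm t * e / 4.
  rewrite exprMn mulrCA expr2 -mulrA -[rnorm t * e / 4]mulrA.
  apply: ler_wpM2l; first exact: ltW.
  by lra.
clear t1 c1 c2 m0 te w04 d10 d20 wr wr' wd1 wd2 wd1' wd2' tvr K0; lra.
Qed.

(** The differentials at the points where [h] does not vanish converge pointwise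
as these points approach [w0]; the limit is linear and inherits the uniform
Taylor estimate, which is what differentiability at [w0] requires. *)
Lemma differentiable_limit : differentiable f w0.
Proof.
have K0 := taylor_const_ge0; have rr := r0.
have w04 : rnorm (w0 - w0) < 4 * r by rewrite subrr rnorm0; lra.
have [Vw0 _] := ball_bound w04.
(* The filter of the points that approach [w0] outside the zeros of [h]. *)
pose F := within (fun w => h w != 0) (nbhs w0).
have FF : ProperFilter F.
  apply: Build_ProperFilter_ex => A /nbhs_rnormP[d d0 dA].
  by have [w wd hw] := dense Vw0 d0; exists w; exact: dA.
have Fnear d : 0 < d -> F (fun w => rnorm (w - w0) < d /\ h w != 0).
  by move=> d0; apply/nbhs_rnormP; exists d.
have lims v : exists c : C R, (fun w => 'd f w v) @ F --> c.
  apply: cauchy_complex => e e0; have [d d0 dD] := derivative_cauchy v e0.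
  exists (fun w => rnorm (w - w0) < d /\ h w != 0); first exact: Fnear.
  by move=> x y [? ?] [? ?]; exact: dD.
have [D DP] := choice lims.
have Dlin : linear (D : W -> C R).
  move=> a u v; apply: (@cvg_unique (C R) _ ((fun w => 'd f w (a *: u + v)) @ F));
    [exact: norm_hausdorff|exact: DP|].
  rewrite /mkset /=.
  rewrite (_ : (fun w => _) = (fun w => a * 'd f w u + 'd f w v)); last first.
    by apply/funext => w; rewrite linearP.
  have Da : (fun w => a * 'd f w u) @ F --> a * D u.
    exact: (@cvgM (C R) _ _ _ (fun=> a) _ _ _ (cvg_cst a) (DP u)).
  exact: (@cvgD (C R) (C R) _ _ _ _ _ _ _ Da (DP v)).
pose L := GRing.isLinear.Build _ _ _ _ D Dlin.
pose Dl : {linear W -> C R} := HB.pack D L.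
have bound v : rnorm v < r / 2 -> rnorm (f (w0 + v) - f w0 - D v) <= taylor_const * rnorm v ^+ 2.
  move=> vr; apply/ler_addgt0Pr => e e0; have e3 : 0 < e / 3 by lra.
  have [Vt _] : V (w0 + v) /\ rnorm (f (w0 + v)) <= M.
    by apply: ball_bound; rewrite addrAC subrr add0r; lra.
  have /continuous_rnormP/(_ _ e3)[d1 d10 d1F] := fc Vw0.
  have /continuous_rnormP/(_ _ e3)[d2 d20 d2F] := fc Vt.
  have m0 : 0 < Num.min r (Num.min d1 d2) by rewrite !lt_min r0 d10.
  have /cvg_rnormP/(_ _ e3) DPv := DP v.
  have [w [/= [wm hw] wD]] := filter_ex (filterI (Fnear _ m0) DPv).
  move: wm; rewrite !lt_min => /andP[wr /andP[wd1 wd2]].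
  have H1 := taylor_bound wr vr hw.
  have A1 := d1F _ wd1.
  have A3 : rnorm (f (w + v) - f (w0 + v)) < e / 3.
    by apply: d2F; rewrite opprD addrACA subrr addr0.
  have -> : f (w0 + v) - f w0 - D v = (f (w + v) - f w - 'd f w v) +
    ((f w - f w0) + ('d f w v - D v) - (f (w + v) - f (w0 + v))) by ring.
  have B1 := rnormD (f (w + v) - f w - 'd f w v)
    ((f w - f w0) + ('d f w v - D v) - (f (w + v) - f (w0 + v))).
  have B2 := rnormB_le ((f w - f w0) + ('d f w v - D v)) (f (w + v) - f (w0 + v)).
  have B3 := rnormD (f w - f w0) ('d f w v - D v).
  by move: B1 B2 B3 H1 A1 A3 wD; lra.
apply/differentiable_rnormP; exists Dl.
- have /continuous_rnormP/(_ 1 ltr01)[d d0 dF] := fc Vw0.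
  pose s := Num.min d (r / 2) / 2.
  have m0 : 0 < Num.min d (r / 2) by rewrite lt_min d0 divr_gt0.
  have s0 : 0 < s by rewrite divr_gt0.
  have sm : s < Num.min d (r / 2) by rewrite /s; lra.
  move: sm; rewrite lt_min => /andP[sd sr].
  pose B := 1 + taylor_const * s ^+ 2.
  apply: (@linear_bounded_continuous_rnorm _ _ _ _ (B / s)) => v.
  have [->|v0] := eqVneq v 0; first by rewrite linear0 !rnorm0 mulr0.
  have nv0 : 0 < rnorm v by rewrite rnorm_gt0.
  pose t : C R := (s / rnorm v)%:C.
  have nt : rnorm t = s / rnorm v by rewrite rnorm_real gtr0_norm// divr_gt0.
  have ntv : rnorm (t *: v) = s by rewrite rnormZ nt divfK// gt_eqF.
  have H1 := bound (t *: v); rewrite ntv in H1; have {}H1 := H1 sr.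
  have H2 : rnorm (f (w0 + t *: v) - f w0) < 1 by apply: dF; rewrite addrAC subrr add0r ntv.
  have H3 : rnorm (Dl (t *: v)) <= B.
    have -> : Dl (t *: v) = (f (w0 + t *: v) - f w0) -
      (f (w0 + t *: v) - f w0 - D (t *: v)) by rewrite subKr.
    by apply: le_trans (rnormB_le _ _) _; rewrite /B; lra.
  move: H3; rewrite linear_mul rnormM nt mulrAC ler_pdivrMr// => H3.
  by rewrite mulrAC ler_pdivlMr// mulrC.
- move=> e e0; have K1 : 0 < taylor_const + 1 by lra.
  exists (Num.min (r / 2) (e / (taylor_const + 1))); first by rewrite lt_min !divr_gt0.
  move=> v; rewrite lt_min => /andP[vr]; rewrite ltr_pdivlMr// => ve.
  apply: le_trans (bound v vr) _; rewrite expr2 mulrA.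
  apply: ler_wpM2r; first exact: rnorm_ge0.
  have := rnorm_ge0 v; nra.
Qed.

End RadoSeveral.

(** A continuous function which is holomorphic off the zeros of [h] is holomorphic,
as soon as [h] is itself of this kind and its zeros have empty interior. The
argument runs on complex lines, whatever the dimension. *)
Theorem rado_differentiable (R : realType) (W : normedModType (C R)) (V : set W)
    (f h : W -> C R) : open V ->
  (forall w, V w -> {for w, continuous f}) ->
  (forall w, V w -> {for w, continuous h}) ->
  (forall w, V w -> h w != 0 -> differentiable f w) ->
  (forall w, V w -> h w != 0 -> differentiable h w) ->
  (forall w, V w -> forall d : R, 0 < d -> exists2 w', rnorm (w' - w) < d & h w' != 0) ->
  forall w, V w -> differentiable f w.
Proof.
move=> oV fc hc df dh dense w0 Vw0.
have /nbhs_rnormP[d1 d10 d1V] : nbhs w0 V by apply: open_nbhs_nbhs.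
have /continuous_rnormP/(_ 1 ltr01)[d2 d20 d2F] := fc _ Vw0.
have m0 : 0 < Num.min d1 d2 by rewrite lt_min d10.
have r0 : 0 < Num.min d1 d2 / 4 by rewrite divr_gt0.
apply: (@differentiable_limit R W V f h fc hc df dh w0 (Num.min d1 d2 / 4)
  (rnorm (f w0) + 1) r0 _ dense).
move=> w; rewrite (_ : 4 * (Num.min d1 d2 / 4) = Num.min d1 d2); last by field.
rewrite lt_min => /andP[wd1 wd2]; split; first exact: d1V.
by rewrite -[f w](subrK (f w0)) addrC (le_trans (rnormD _ _))// lerD2l ltW// d2F.
Qed.

(** * Row vectors over the complex numbers *)

Section RowVectors.
Local Open Scope complex_scope.
Context {R : realType} {d : nat}.
Implicit Types x y : Cn R d.

(** The norm of a row vector is the maximum of the norms of its entries; balls are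
products of discs. *)
Lemma rnorm_rV_lt x (e : R) : 0 < e -> rnorm x < e <-> forall i, rnorm (x ord0 i) < e.
Proof.
move=> e0.
have key (V : normedModType (C R)) (y : V) : rnorm y < e <-> ball (0 : V) (e%:C : C R) y.
  by rewrite -ball_normE /= sub0r normrN rnormE ltcR.
rewrite key; split=> [[_ xe] i|xe].
  by apply/key; have := xe ord0 i; rewrite mxE.
by split=> [|j i]; [rewrite ltcR|rewrite (ord1 j) mxE; apply/key].
Qed.

Lemma rnorm_coord_le x i : rnorm (x ord0 i) <= rnorm x.
Proof.
rewrite leNgt; apply/negP => h.
have e0 : 0 < rnorm (x ord0 i) by apply: le_lt_trans h; exact: rnorm_ge0.
by have := (rnorm_rV_lt x e0).1 h i; rewrite ltxx.
Qed.

Lemma rnorm_rV_le x (e : R) : 0 <= e -> (forall i, rnorm (x ord0 i) <= e) -> rnorm x <= e.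
Proof.
move=> e0 xe; apply/ler_addgt0Pr => t t0; apply/ltW/rnorm_rV_lt; first lra.
by move=> i; have := xe i; lra.
Qed.

Lemma rnorm_sum (I : finType) (F : I -> C R) : rnorm (\sum_i F i) <= \sum_i rnorm (F i).
Proof.
apply: (big_ind2 (fun (a : C R) (b : R) => rnorm a <= b)) => //.
- by rewrite rnorm0.
- by move=> a b a' b' h h'; apply: le_trans (rnormD _ _) (lerD h h').
Qed.

Lemma rnorm_mulmx (M : 'M[C R]_d) : exists2 k : R, 0 < k & forall x, rnorm (x *m M) <= k * rnorm x.
Proof.
have k0 : 0 <= \sum_i \sum_j rnorm (M j i) by do 2 apply: sumr_ge0 => ? _; exact: rnorm_ge0.
exists (\sum_i \sum_j rnorm (M j i) + 1); first by lra.
move=> x; apply: rnorm_rV_le => [|i]; first by rewrite mulr_ge0 ?rnorm_ge0//; lra.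
rewrite mxE; apply: le_trans (rnorm_sum _) _.
apply: (@le_trans _ _ (\sum_j rnorm (M j i) * rnorm x)).
  by apply: ler_sum => j _; rewrite rnormM mulrC ler_wpM2l ?rnorm_ge0// rnorm_coord_le.
rewrite -mulr_suml ler_wpM2r ?rnorm_ge0//.
rewrite [leRHS](_ : _ = \sum_j rnorm (M j i) +
  (\sum_(i' | i' != i) \sum_j rnorm (M j i') + 1)).
  by rewrite lerDl addr_ge0//; do 2 apply: sumr_ge0 => ? _; exact: rnorm_ge0.
by rewrite (bigD1 i)//= addrA.
Qed.

Definition polydisc (a : Cn R d) (r : R) : set (Cn R d) :=
  [set x | forall i, disc (a ord0 i) r (x ord0 i)].

Lemma compact_polydisc (a : Cn R d) (r : R) : compact (polydisc a r).
Proof. apply: (@rV_compact (C R) d (fun i => disc (a ord0 i) r)) => i.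
exact: compact_disc. Qed.

End RowVectors.

(** * Sets with at most two elements *)

Section Cardinality.
Local Open Scope card_scope.
Variables (T : Type) (A : set T).

Lemma card_lt2_eq k (a b : T) : (k < 2)%N -> A #= `I_k -> A a -> A b -> a = b.
Proof.
move=> k2 /pcard_eqP[f] Aa Ab.
have /(_ a b (mem_set Aa) (mem_set Ab)) := @inj _ _ A f; apply.
have := @funS _ _ _ _ f _ Aa; have := @funS _ _ _ _ f _ Ab; rewrite /= => h1 h2.
by case: (f a) h2 => [|[|?]]; case: (f b) h1 => [|[|?]] //; case: k k2 {f} => [|[|]].
Qed.

Lemma card_2_cases (a b c : T) : A #= `I_2 -> A a -> A b -> A c -> a <> b -> c = a \/ c = b.
Proof.
move=> /pcard_eqP[f] Aa Ab Ac ab.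
have fi x y : A x -> A y -> f x = f y -> x = y.
  by move=> Ax Ay; have /(_ x y (mem_set Ax) (mem_set Ay)) := @inj _ _ A f.
have := @funS _ _ _ _ f _ Aa; have := @funS _ _ _ _ f _ Ab; have := @funS _ _ _ _ f _ Ac.
rewrite /= => h1 h2 h3.
have fab : f a <> f b by move=> /(fi _ _ Aa Ab).
suff : f c = f a \/ f c = f b by case=> /fi h; [left|right]; exact: h.
by case: (f a) h3 fab => [|[|?]]//; case: (f b) h2 => [|[|?]]//;
  case: (f c) h1 => [|[|?]]// *; (left; done) || (right; done).
Qed.

Lemma card_2_nonempty : A #= `I_2 -> exists a, A a.
Proof.
move=> /pcard_eqP[f].
have [//|x Ax _] := surj (f := f) (t := 0%N).
by exists x.
Qed.

End Cardinality.

(** * Descent along a quotient by an involution *)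

Section Descent.
Context {R : realType} {d : nat}.
Variables (U V : set (Cn R d)) (sigma phi : Cn R d -> Cn R d).
Hypothesis oU : open U.
Hypothesis oV : open V.
Hypothesis sigma_affine : affine_linear sigma.
Hypothesis sigma_invol : is_involution sigma.
Hypothesis sigma_jac : forall z, jac_det sigma z = -1.
Hypothesis phi_inv : invariant_map sigma U phi.
Hypothesis phi_proper : m_proper_holomorphic 2 U V phi.

Lemma sigmaK z : sigma (sigma z) = z.
Proof. by have [_ /(congr1 (fun f => f z))] := sigma_invol. Qed.

Lemma sigmaU z : U z -> U (sigma z).
Proof. exact: phi_inv.1. Qed.

Lemma phi_sigma z : U z -> phi (sigma z) = phi z.
Proof. exact: phi_inv.2. Qed.

Lemma phi_diff z : U z -> differentiable phi z.
Proof. by case: phi_proper => _ + _ _; exact. Qed.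

Lemma phi_into z : U z -> V (phi z).
Proof. by case: phi_proper => -[pUV _ _] _ _ _; exact: pUV. Qed.

Lemma phi_cont z : U z -> {for z, continuous phi}.
Proof. by move=> /phi_diff; exact: differentiable_continuous. Qed.

Lemma sigma_cont z : {for z, continuous sigma}.
Proof. exact: (sigma_invol.1 z). Qed.

Lemma sigma_diff z : differentiable sigma z.
Proof.
have [A [B sE]] := sigma_affine.
have cA : continuous A.
  move=> x; apply/continuous_rnormP => e e0.
  have /continuous_rnormP/(_ _ e0)[r r0 h] := @sigma_cont x.
  by exists r => // y /h; rewrite !sE opprD addrACA subrr addr0.
rewrite (_ : sigma = (fun z => A z + B)); last by apply/funext.
by apply: differentiableD; [exact: linear_differentiable|exact: differentiable_cst].
Qed.

Lemma near_U z : U z -> \forall w \near z, U w.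
Proof. by move=> Uz; apply: open_nbhs_nbhs. Qed.

(** The chain rule for [phi \o sigma = phi] at the fixed point reads
[J_phi = J_sigma * J_phi], that is, [J_phi = - J_phi]. *)
Lemma fixed_critical z : U z -> sigma z = z -> jac_det phi z = 0.
Proof.
move=> Uz sz.
have dphi : differentiable phi (sigma z) by rewrite sz; exact: phi_diff.
have E : jacobian phi z = jacobian sigma z *m jacobian phi z.
  apply/row_matrixP => i; rewrite !rowE.
  rewrite mulmxA -[LHS]deriveEjacobian; last exact: phi_diff.
  have -> : 'D_(delta_mx 0 i) phi z = 'D_(delta_mx 0 i) (phi \o sigma) z.
    by apply: near_eq_derive; apply: filterS (near_U Uz) => w Uw /=; rewrite phi_sigma.
  rewrite deriveE; last by apply: differentiable_comp; [exact: sigma_diff|exact: dphi].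
  rewrite diff_comp; [|exact: sigma_diff|exact: dphi].
  by rewrite /= sz /jacobian !mul_rV_lin1.
have : jac_det phi z = jac_det sigma z * jac_det phi z.
  exact: (etrans (congr1 determinant E) (det_mulmx _ _)).
by rewrite sigma_jac mulN1r => /eqP; rewrite -addr_eq0 -mulr2n mulrn_eq0 => /orP[//|/eqP].
Qed.

(** The fibre over a critical value has fewer than two elements, and contains
both [z] and [sigma z]. *)
Lemma critical_fixed z : U z -> jac_det phi z = 0 -> sigma z = z.
Proof.
move=> Uz jz; have [_ _ _ H] := phi_proper.
have [|k k2 fk] := H (phi z); first by exists z.
apply: (card_lt2_eq k2 fk); split => //=; first exact: sigmaU.
exact: phi_sigma.
Qed.

Lemma fiber_orbit z z' : U z -> U z' -> phi z' = phi z -> z' = z \/ z' = sigma z.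
Proof.
move=> Uz Uz' pz; have [_ _ H2 H] := phi_proper.
have [cw|ncw] := pselect (critical_values U phi (phi z)).
  by have [k k2 fk] := H _ cw; left; apply: (card_lt2_eq k2 fk).
have f2 := H2 (phi z) (conj (phi_into Uz) ncw).
have fz : fiber U phi (phi z) z by split.
have fsz : fiber U phi (phi z) (sigma z) by split; [exact: sigmaU|exact: phi_sigma].
have fz' : fiber U phi (phi z) z' by split.
apply: (card_2_cases f2 fz fsz fz') => sz; apply: ncw; exists z => //; split => //.
exact: fixed_critical.
Qed.

Lemma phi_onto w : V w -> exists2 z, U z & phi z = w.
Proof.
move=> Vw; have [_ _ H2 H] := phi_proper.
have [[z [Uz _] <-]|ncw] := pselect (critical_values U phi w); first by exists z.
have [z [Uz pz]] := card_2_nonempty (H2 w (conj Vw ncw)).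
by exists z.
Qed.

(** Otherwise the points outside [N] with image near [w0] lie in the preimage of
a compact polydisc, which is compact by properness; they cluster at a point of
the fibre of [w0], of which [N] is a neighbourhood. *)
Lemma phi_closed w0 (N : set (Cn R d)) : V w0 ->
  (forall z, U z -> phi z = w0 -> nbhs z N) ->
  exists2 e : R, 0 < e & forall z, U z -> rnorm (phi z - w0) < e -> N z.
Proof.
move=> Vw0 fN; apply: contrapT => H.
have /nbhs_rnormP[r r0 rV] : nbhs w0 V by apply: open_nbhs_nbhs.
have r2 : 0 < r / 2 by rewrite divr_gt0.
pose K := polydisc w0 (r / 2).
have KV : K `<=` V.
  move=> w Kw; apply: rV; apply: (@le_lt_trans _ _ (r / 2)); last lra.
  apply: rnorm_rV_le; first exact: ltW.
  by move=> i; have := Kw i; rewrite /disc /= !mxE.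
have [[_ _ /(_ K KV (@compact_polydisc R d w0 (r / 2)))] cP _ _ _] := phi_proper.
pose B (e : R) := [set z | [/\ U z, rnorm (phi z - w0) < e & ~ N z]].
pose G := filter_from [set e : R | 0 < e] B.
have GF : ProperFilter G.
  apply: filter_from_proper; last first.
    move=> e e0; apply: contrapT => h; apply: H; exists e => // z Uz ze.
    by apply: contrapT => Nz; apply: h; exists z.
  apply: filter_from_filter; first by exists 1 => /=.
  move=> i j i0 j0; exists (Num.min i j); first by rewrite /= lt_min i0.
  by move=> z [Uz + Nz]; rewrite lt_min => /andP[zi zj]; split.
have GP : G (U `&` phi @^-1` K).
  exists (r / 2) => // z [Uz zr _]; split => // i; rewrite /disc /=.
  by have := rnorm_coord_le (phi z - w0) i; rewrite !mxE => h; apply: le_trans h (ltW zr).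
have [p [[Up _] clp]] := cP G GF GP.
have pw : phi p = w0.
  apply: contrapT => np.
  have n0 : 0 < rnorm (phi p - w0) / 2 by rewrite divr_gt0// rnorm_gt0 subr_eq0; apply/eqP.
  have /continuous_rnormP/(_ _ n0)[e e0 pe] := phi_cont Up.
  have Gn : G (B (rnorm (phi p - w0) / 2)) by exists (rnorm (phi p - w0) / 2).
  have Np : nbhs p [set z | rnorm (z - p) < e] by apply/nbhs_rnormP; exists e.
  have [z [[_ zw _] /pe zp]] := clp _ _ Gn Np.
  have := rnorm_triangle (phi p) (phi z) w0; rewrite (rnorm_distC (phi p) (phi z)).
  by move=> /le_lt_trans/(_ (ltrD zp zw)); rewrite -splitr ltxx.
have GB : G (B 1) by exists 1 => //=; exact: ltr01.
have [z [[_ _ nN] Nz]] := clp _ _ GB (fN p Up pw).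
exact: nN.
Qed.

(** A point that [sigma] moves is not critical, so the inverse of the Jacobian
matrix inverts the differential. *)
Lemma jac_inverse z : U z -> sigma z != z ->
  exists2 T : {linear Cn R d -> Cn R d},
    (exists2 k : R, 0 < k & forall u, rnorm (T u) <= k * rnorm u) &
    forall u, T ('d phi z u) = u.
Proof.
move=> Uz sz.
have ju : jacobian phi z \in unitmx.
  rewrite unitmxE unitfE; apply/eqP => /(critical_fixed Uz) h.
  by rewrite h eqxx in sz.
have [k k0 kT] := rnorm_mulmx (invmx (jacobian phi z)).
exists (mulmxr (invmx (jacobian phi z))); first by exists k.
move=> u /=; rewrite -[X in X *m _](mul_rV_lin1 ('d phi z)) -/(jacobian phi z).
exact: mulmxK.
Qed.

Variables (g f : Cn R d -> C R).
Hypothesis g_inv : forall z, U z -> g (sigma z) = g z.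
Hypothesis fg : forall z, U z -> f (phi z) = g z.
Hypothesis gc : forall z, U z -> {for z, continuous g}.

Lemma descent_continuous w0 : V w0 -> {for w0, continuous f}.
Proof.
move=> Vw0; have [z0 Uz0 pz0] := phi_onto Vw0.
apply/continuous_rnormP => e e0.
have [z Uz pz|e1 e10 eN] := @phi_closed w0 [set z | rnorm (g z - g z0) < e] Vw0.
  have <- : g z = g z0.
    by rewrite -pz0 in pz; have [->//|->] := fiber_orbit Uz0 Uz pz; exact: g_inv.
  have /continuous_rnormP/(_ _ e0)[e2 e20 h] := gc Uz.
  by apply/nbhs_rnormP; exists e2.
have /nbhs_rnormP[e2 e20 eV] : nbhs w0 V by apply: open_nbhs_nbhs.
exists (Num.min e1 e2); first by rewrite lt_min e10.
move=> w; rewrite lt_min => /andP[we1 /eV Vw].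
have [z Uz pz] := phi_onto Vw.
by rewrite -pz -pz0 !fg//; apply: eN => //; rewrite pz.
Qed.

(** A preimage [z] of a point near [phi z0] can be taken near [z0], exchanging it
with [sigma z] if necessary. Invertibility of the differential of [phi] bounds
[z - z0] by a multiple of [phi z - phi z0], so that the expansions of [g] and
[phi] at [z0] combine into one of [f] at [phi z0]. *)
Lemma descent_differentiable z0 : U z0 -> sigma z0 != z0 -> differentiable g z0 ->
  differentiable f (phi z0).
Proof.
move=> Uz0 sz0 dg.
have Vw0 := phi_into Uz0.
have [T [k k0 kT] TD] := jac_inverse Uz0 sz0.
have [l l0 lg] := continuous_linear_rnorm (diff_continuous dg).
pose L : {linear Cn R d -> C R} := 'd g z0 \o T.
apply/differentiable_rnormP; exists L.
  apply: (@linear_bounded_continuous_rnorm _ _ _ _ (l * k)) => u.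
  apply: le_trans (lg _) _; rewrite -mulrA; apply: ler_wpM2l; first exact: ltW.
  exact: kT.
move=> e e0.
pose e1 := Num.min (1 / (2 * k)) (e / (4 * l * k ^+ 2)).
have e10 : 0 < e1.
  by rewrite lt_min !divr_gt0 ?mulr_gt0 ?exprn_gt0.
pose e2 := e / (4 * k).
have e20 : 0 < e2 by rewrite divr_gt0// mulr_gt0.
have [d1 d10 d1P] := differentiable_bound (phi_diff Uz0) e10.
have [d2 d20 d2P] := differentiable_bound dg e20.
pose r := Num.min d1 d2.
have r0 : 0 < r by rewrite lt_min d10.
(* [N] is a neighbourhood of the whole fibre. *)
pose N := [set z | rnorm (z - z0) < r \/ rnorm (sigma z - z0) < r].
have [z Uz pz|e3 e30 eN] := @phi_closed (phi z0) N Vw0.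
  have [->|->] := fiber_orbit Uz0 Uz pz.
    by apply/nbhs_rnormP; exists r => // y; left.
  have /continuous_rnormP/(_ _ r0)[e4 e40 h] := @sigma_cont (sigma z0).
  by apply/nbhs_rnormP; exists e4 => // y /h; rewrite sigmaK; right.
have /nbhs_rnormP[e4 e40 eV] : nbhs (phi z0) V by apply: open_nbhs_nbhs.
exists (Num.min e3 e4); first by rewrite lt_min e30.
move=> u; rewrite lt_min => /andP[ue3 ue4].
have Vu : V (phi z0 + u) by apply: eV; rewrite addrAC subrr add0r.
have [z [Uz pz zr]] : exists z, [/\ U z, phi z = phi z0 + u & rnorm (z - z0) < r].
  have [z Uz pz] := phi_onto Vu.
  have [] : N z by apply: eN => //; rewrite pz addrAC subrr add0r.
  - by exists z.
  - by exists (sigma z); split=> //; [exact: sigmaU|rewrite phi_sigma].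
rewrite -pz !fg//.
have [v vE] : exists v, v = z - z0 by exists (z - z0).
have zE : z = z0 + v by rewrite vE subrKC.
move: zr; rewrite -vE lt_min => /andP[/d1P v1 /d2P v2].
rewrite -zE pz [phi z0 + u]addrC addrK in v1; rewrite -zE in v2.
have E1 : rnorm v <= 2 * k * rnorm u.
  have h1 : rnorm v <= k * rnorm ('d phi z0 v) by rewrite -{1}(TD v); exact: kT.
  have h2 : rnorm ('d phi z0 v) <= rnorm u + e1 * rnorm v.
    rewrite -[X in rnorm X](subKr u); apply: le_trans (rnormB_le _ _) _.
    by rewrite lerD2l.
  have h3 : e1 <= 1 / (2 * k) by rewrite ge_min lexx.
  have h4 : k * e1 <= 1 / 2.
    by move: h3; rewrite ler_pdivlMr ?mulr_gt0//; lra.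
  have v0 := rnorm_ge0 v.
  have h5 : k * rnorm ('d phi z0 v) <= k * (rnorm u + e1 * rnorm v) by rewrite ler_wpM2l// ltW.
  have h6 : k * e1 * rnorm v <= 1 / 2 * rnorm v by rewrite ler_wpM2r.
  by move: h1 h5 h6; lra.
have -> : g z - g z0 - L u = (g z - g z0 - 'd g z0 v) - 'd g z0 (T (u - 'd phi z0 v)).
  have -> : T (u - 'd phi z0 v) = T u - v by rewrite linearB TD.
  by rewrite (linearB ('d g z0)) opprB addrA subrK.
apply: le_trans (rnormB_le _ _) _.
have E2 : rnorm ('d g z0 (T (u - 'd phi z0 v))) <= l * (k * (e1 * rnorm v)).
  apply: le_trans (lg _) _; rewrite ler_wpM2l ?(ltW l0)//.
  by apply: le_trans (kT _) _; rewrite ler_wpM2l ?(ltW k0)//.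
have E3 : l * (k * (e1 * rnorm v)) <= e / (4 * k) * rnorm v.
  have : e1 <= e / (4 * l * k ^+ 2) by rewrite ge_min lexx orbT.
  move=> h; rewrite !mulrA ler_wpM2r ?rnorm_ge0//.
  have -> : e / (4 * k) = l * k * (e / (4 * l * k ^+ 2)) by field; rewrite !gt_eqF.
  by rewrite ler_wpM2l// ltW// mulr_gt0.
have E4 : e / (4 * k) * rnorm v <= e / 2 * rnorm u.
  have -> : e / 2 * rnorm u = e / (4 * k) * (2 * k * rnorm u) by field; rewrite gt_eqF.
  by rewrite ler_wpM2l// ltW.
by move: v2 E2 E3 E4; rewrite /e2; lra.
Qed.

End Descent.

(** * The displacement of an affine involution *)

Section Moving.
Local Open Scope complex_scope.
Context {R : realType} {d : nat}.
Variables (sigma : Cn R d -> Cn R d).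
Hypothesis sigma_affine : affine_linear sigma.
Hypothesis sigma_invol : is_involution sigma.
Hypothesis sigma_jac : forall z, jac_det sigma z = -1.

(** Its square is invariant, and vanishes at the fixed points of [sigma]: this is
the function that controls the exceptional set. *)
Definition displacement (i : 'I_d) (z : Cn R d) : C R := (z - sigma z) ord0 i.

Lemma displacement_sigma i z : displacement i (sigma z) = - displacement i z.
Proof. by rewrite /displacement (sigmaK sigma_invol) -opprB mxE. Qed.

Lemma displacement_affine i (z0 z1 : Cn R d) (t : C R) :
  displacement i (z0 + t *: (z1 - z0)) =
  displacement i z0 + t * (displacement i z1 - displacement i z0).
Proof.
have [A [B sE]] := sigma_affine.
have EA : A (z0 + t *: (z1 - z0)) = A z0 + t *: (A z1 - A z0).
  by rewrite linearD linearZ_LR linearB.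
rewrite /displacement !sE EA.
by rewrite !mxE; ring.
Qed.

Lemma displacement_diff i z : differentiable (displacement i) z.
Proof.
apply: (@differentiable_comp _ _ _ _ (fun z => z - sigma z) (fun x : Cn R d => x ord0 i)).
  by apply: differentiableB; [by have [] := is_diff_id z|exact: sigma_diff].
exact: differentiable_coord.
Qed.

(** The identity has Jacobian determinant 1. *)
Lemma sigma_moves : exists i z, displacement i z != 0.
Proof.
apply: contrapT => h.
have sid : sigma = id.
  apply/funext => z; apply/rowP => i; apply/eqP; rewrite eq_sym -subr_eq0.
  apply/negP => /negP zi; apply: h; exists i, z.
  by rewrite /displacement !mxE.
have := sigma_jac 0; rewrite sid /jac_det /jacobian.
rewrite (_ : lin1_mx _ = 1%:M); last first.
  apply/row_matrixP => j; rewrite !rowE mul_rV_lin1 mulmx1.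
  by rewrite diff_val.
rewrite det1 => /eqP; rewrite -subr_eq0 opprK -mulr2n => /eqP h2.
by have := pnatr_eq0 (C R) 2; rewrite h2 eqxx.
Qed.

(** An affine function that is not identically zero does not vanish identically on
the segment from [z] to a point where it does not vanish. *)
Lemma displacement_dense i : (exists z, displacement i z != 0) ->
  forall z (e : R), 0 < e -> exists2 z', rnorm (z' - z) < e & displacement i z' != 0.
Proof.
move=> [z1 z1i] z e e0.
have [zi|zi] := eqVneq (displacement i z) 0; last by exists z => //; rewrite subrr rnorm0.
have n0 := rnorm_ge0 (z1 - z).
pose t := e / (rnorm (z1 - z) + 1).
have t0 : 0 < t by rewrite divr_gt0//; lra.
exists (z + t%:C *: (z1 - z)).
  rewrite addrAC subrr add0r rnormZ rnorm_real gtr0_norm// /t mulrAC ltr_pdivrMr; last lra.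
  by rewrite ltr_pM2l//; lra.
rewrite displacement_affine zi add0r subr0 mulf_neq0//.
by rewrite -rnorm_gt0 rnorm_real gtr0_norm.
Qed.

End Moving.

(** * The invariant holomorphic functions *)

Theorem theorem2p8 (R : realType) (d : nat) (U V : set (Cn R d))
    (sigma phi : Cn R d -> Cn R d)
    (domU : domain U) (domV : domain V)
    (sigma_affine : affine_linear sigma)
    (sigma_invol : is_involution sigma)
    (sigma_jac : forall z, jac_det sigma z = -1)
    (phi_inv : invariant_map sigma U phi)
    (phi_proper : m_proper_holomorphic 2 U V phi) :
  [set g | Hol U g /\ (forall z, U z -> g (sigma z) = g z)]
  = [set (f \o phi) \_ U | f in Hol V].
Proof.
have [_ oU _] := domU; have [_ oV _] := domV.
have phV z (Uz : U z) := phi_into phi_proper Uz.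
have phd z (Uz : U z) := phi_diff phi_proper Uz.
have phc z (Uz : U z) := phi_cont phi_proper Uz.
have sU z : U z -> U (sigma z) by exact: phi_inv.1.
have restrV (F : Cn R d -> C R) z : U z -> ((F \_ V) \o phi) z = F (phi z).
  by move=> Uz; rewrite -[LHS]/((F \_ V) (phi z)) patchE mem_set//; exact: phV.
apply/seteqP; split=> [g0 [[g gH <-] gs]|_ [_ [f fH <-] <-]].
- have restr (F : Cn R d -> C R) z : U z -> (F \_ U) z = F z.
    by move=> Uz; rewrite patchE mem_set.
  have {}gs z : U z -> g (sigma z) = g z.
    by move=> Uz; have := gs z Uz; rewrite !restr//; exact: sU.
  have gc z : U z -> {for z, continuous g} by move=> /gH; exact: differentiable_continuous.
  (* [desc G] is the function on [V] through which an invariant [G] factors. *)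
  pose desc (G : Cn R d -> C R) (w : Cn R d) : C R :=
    if pselect (exists2 z, U z & phi z = w) is left H then G (projT1 (cid2 H)) else 0.
  have descE G z : (forall z, U z -> G (sigma z) = G z) -> U z -> desc G (phi z) = G z.
    move=> Gs Uz; rewrite /desc; case: pselect => [H|[]]; last by exists z.
    case: (cid2 H) => z' Uz' pz' /=.
    have := fiber_orbit oU sigma_affine sigma_invol sigma_jac phi_inv phi_proper Uz Uz' pz'.
    by move=> [->//|->]; exact: Gs.
  have [i [z1 z1i]] := sigma_moves sigma_jac.
  pose l z := displacement sigma i z * displacement sigma i z.
  have ls z : U z -> l (sigma z) = l z by rewrite /l displacement_sigma// mulrNN.
  have ld z : differentiable l z by apply: differentiableM; exact: displacement_diff.
  have lc z : U z -> {for z, continuous l} by move=> _; apply: differentiable_continuous.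
  have fE z (Uz : U z) : desc g (phi z) = g z := descE g z gs Uz.
  have hE z (Uz : U z) : desc l (phi z) = l z := descE l z ls Uz.
  have fc := descent_continuous oU oV sigma_affine sigma_invol sigma_jac
    phi_inv phi_proper gs fE gc.
  have hc := descent_continuous oU oV sigma_affine sigma_invol sigma_jac
    phi_inv phi_proper ls hE lc.
  have moved z : l z != 0 -> sigma z != z.
    by apply: contraNneq => sz; rewrite /l /displacement sz subrr mxE mul0r.
  have onto := phi_onto phi_proper.
  have fd w : V w -> desc l w != 0 -> differentiable (desc g) w.
    move=> /onto[z Uz <-]; rewrite hE// => /moved sz.
    have dg : differentiable g z := gH z Uz.
    have := @descent_differentiable R d U V sigma phi oU oV sigma_affine sigma_invol
      sigma_jac phi_inv phi_proper g (desc g) fE z Uz sz dg.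
    exact.
  have hd w : V w -> desc l w != 0 -> differentiable (desc l) w.
    move=> /onto[z Uz <-]; rewrite hE// => /moved sz.
    have := @descent_differentiable R d U V sigma phi oU oV sigma_affine sigma_invol
      sigma_jac phi_inv phi_proper l (desc l) hE z Uz sz (ld z).
    exact.
  have dense w : V w -> forall e : R, 0 < e -> exists2 w', rnorm (w' - w) < e & desc l w' != 0.
    move=> /onto[z Uz <-] e e0.
    have /continuous_rnormP/(_ _ e0)[r r0 rP] := phc z Uz.
    have /nbhs_rnormP[r' r'0 r'U] := near_U oU Uz.
    have m0 : 0 < Num.min r r' by rewrite lt_min r0.
    have [z'] := displacement_dense sigma_affine (ex_intro _ z1 z1i) z m0.
    rewrite lt_min => /andP[zr zr'] lz'; exists (phi z'); first exact: rP.
    by rewrite hE ?mulf_neq0//; exact: r'U.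
  have fV := rado_differentiable oV fc hc fd hd dense.
  exists (desc g \_ V); first by exists (desc g).
  apply/funext => z; rewrite !patchE; case: ifP => // /set_mem Uz.
  by rewrite restrV//; exact: fE.
- split; last first.
    move=> z Uz; rewrite !patchE !mem_set//; last exact: sU.
    by rewrite /= phi_inv.2.
  exists (f \o phi).
    move=> z Uz; apply: differentiable_comp; first exact: phd.
    by apply: fH; exact: phV.
  apply/funext => z; rewrite !patchE; case: ifP => // /set_mem Uz.
  by rewrite restrV.
Qed.
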